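(* Let $\phi,\psi$ satisfy the wavelet condition (with constants $0<a'<a$) described in the context. For every $1\le p<\infty$ there exists a constant $L'$ depending only on $\phi,\psi,p$, and there exists a constant $C$ depending only on $\phi,\psi$, such that the following holds. Let $j\ge0$, let the error law $\varphi$ satisfy $|F[\varphi](t)|>0$ on $[-2^ja,2^ja]$, put $\delta_j=\min_{t\in[-2^ja,2^ja]}|F[\varphi](t)|$ and $j'=\max(1,j)$, and assume that $X$ has a bounded density $f:\mathbb{R}\to[0,\infty)$. Let $G=\max(\|g\|_\infty^{1/2},1)$, where $g=f\ast\varphi$ is the density of $Y$. Then, for every $n\ge1$, $$\Big(E\Big(\sup_{x\in\mathbb{R}}|f_n(x,j)-Ef_n(x,j)|\Big)^p\Big)^{1/p}\le L'\frac{1}{\delta_j}\left(G\sqrt{\frac{2^jj'}{n}}+\frac{2^jj'}{n}\right),$$ and, for every $n\ge1$ and every $u>0$, $$\Pr\left\{\sup_{x\in\mathbb{R}}|f_n(x,j)-Ef_n(x,j)|\ge\frac{C}{\delta_j}\left(G\sqrt{(1+u)\frac{2^jj'}{n}}+(1+u)\frac{2^jj'}{n}\right)\right\}\le e^{-(1+u)j'}.$$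
   Context: Fourier transform: $F[h](t)=\int h(x)e^{-itx}\,dx$ (extended to $L^2(\mathbb{R})$), $F^{-1}$ its inverse, and $F[\varphi](t)=\int e^{-itx}\,d\varphi(x)$. Model: $Y=X+\epsilon$, with $X$ having density $f$ and $\epsilon$ independent of $X$ with law $\varphi$ (a probability measure on $\mathbb{R}$); $Y_1,\dots,Y_n$ are i.i.d. copies of $Y$. Wavelet condition: $\phi$ and $\psi$ are the (real-valued) scaling function and associated wavelet of an orthonormal multiresolution analysis of $L^2(\mathbb{R})$; $\phi,\psi\in L^p(\mathbb{R})$ for every $1\le p\le\infty$; for some $0<a'<a$, $\operatorname{supp}(F[\phi])\subset[-a,a]$ and $\operatorname{supp}(F[\psi])\subset[-a,a]\setminus[-a',a']$; and $\sup_{x}\sum_{k\in\mathbb{Z}}|\phi(x-k)|<\infty$, $\sup_{x}\sum_{k\in\mathbb{Z}}|\psi(x-k)|<\infty$. Estimator: with $\phi_{0k}(x)=\phi(x-k)$ and $j\ge0$ (possibly real), $$\tilde\phi_{jk}=F^{-1}\left[\frac{F[\phi_{0k}](2^{-j}\cdot)}{2^j\,\overline{F[\varphi]}}\right],\quad K_j^*(x,y)=2^j\sum_{k\in\mathbb{Z}}\phi(2^jx-k)\tilde\phi_{jk}(y),\quad f_n(x,j)=\frac1n\sum_{m=1}^nK_j^*(x,Y_m).$$ *)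

(* Defs.v *)
From HB Require Import structures.
From mathcomp Require Export all_boot all_order all_algebra.
From mathcomp Require Export all_classical all_reals all_analysis.
From mathcomp Require Export complex.

Set Implicit Arguments.
Unset Strict Implicit.
Unset Printing Implicit Defensive.

Import Order.TTheory GRing.Theory Num.Theory.
Import numFieldNormedType.Exports.

Local Open Scope classical_set_scope.
Local Open Scope ring_scope.
Local Open Scope complex_scope.

Section complex_valued.
Context {R : realType}.

Definition cabs (z : R[i]) : R := ComplexField.Normc.normc z.

Definition cis (x : R) : R[i] := cos x +i* sin x.

Definition cintegral {d} {T : measurableType d}
    (mu : {measure set T -> \bar R}) (h : T -> R[i]) : R[i] :=
  (\int[mu]_x complex.Re (h x)) +i* (\int[mu]_x complex.Im (h x)).

(* Unconditional sums over the integers.  They have their usual meaning for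
   absolutely summable families, and are only used for such families. *)
Definition zsum (u : int -> R) : R :=
  fine (\esum_(k in [set: int]) ((EFin \o u)^\+ k))%E -
  fine (\esum_(k in [set: int]) ((EFin \o u)^\- k))%E.

Definition zcsum (u : int -> R[i]) : R[i] :=
  zsum (fun k => complex.Re (u k)) +i* zsum (fun k => complex.Im (u k)).

End complex_valued.

Section fourier.
Context {R : realType}.
Local Notation leb := (@lebesgue_measure R).

Definition fourier (h : R -> R[i]) (t : R) : R[i] :=
  cintegral leb (fun x => h x * cis (- (t * x))).

(* The inversion integral is only applied to bounded functions with compact
   support; it is then the continuous representative of the inverse of the
   Fourier transform of L^2. *)
Definition inv_fourier (h : R -> R[i]) (x : R) : R[i] :=
  ((2 * pi)^-1)%:C * cintegral leb (fun t => h t * cis (t * x)).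

Definition fourier_measure (mu : {measure set R -> \bar R}) (t : R) : R[i] :=
  cintegral mu (fun x => cis (- (t * x))).

Definition closed_support (h : R -> R[i]) : set R :=
  closure [set t | h t != 0].

End fourier.

Section wavelets.
Context {R : realType}.
Local Notation leb := (@lebesgue_measure R).
Implicit Types (f g phi psi : R -> R) (V : int -> set (R -> R)).

Definition translate phi (k : int) : R -> R := fun x => phi (x - k%:~R).

Definition L2norm f : \bar R := ('N[leb]_2%:E[EFin \o f])%E.

Definition L2inner f g : R := \int[leb]_x (f x * g x).

(* As phi and psi are real-valued, L^2 is the real Hilbert space.  Its elements
   are represented by functions; a closed subspace is automatically invariant
   under a.e. equality: take u constant in the last condition. *)
Definition closed_subspace (W : set (R -> R)) : Prop :=
  [/\ forall f, W f -> f \in Lfun leb 2%:E,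
      W (fun=> 0),
      forall (c : R) f g, W f -> W g -> W (fun x => c * f x + g x) &
      forall (u : nat -> R -> R) f, (forall n, W (u n)) ->
        f \in Lfun leb 2%:E ->
        L2norm (f \- u n) @[n --> \oo] --> (0 : \bar R)%E ->
        W f].

Definition orthonormal_basis (W : set (R -> R)) (e : int -> R -> R) : Prop :=
  [/\ forall k, W (e k),
      forall k l, L2inner (e k) (e l) = (k == l)%:R &
      forall f, W f -> forall eps : R, 0 < eps ->
        exists (s : seq int) (c : int -> R),
          (L2norm (fun x => f x - \sum_(k <- s) c k * e k x)%R < eps%:E)%E].

Definition multiresolution_analysis V phi : Prop :=
  [/\ forall i, closed_subspace (V i),
      forall i, V i `<=` V (i + 1),
      forall i f, V i f <-> V (i + 1) (fun x => f (2 * x)),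
      (forall f, (forall i, V i f) -> {ae leb, forall x, f x = 0}) /\
      (forall f, f \in Lfun leb 2%:E -> forall eps : R, 0 < eps ->
         exists i g, V i g /\ (L2norm (f \- g)%R < eps%:E)%E) &
      orthonormal_basis (V 0) (translate phi)].

Definition wavelet_space V : set (R -> R) :=
  [set f | V 1 f /\ forall g, V 0 g -> L2inner f g = 0].

Definition scaling_function_and_wavelet phi psi : Prop :=
  exists V, multiresolution_analysis V phi /\
            orthonormal_basis (wavelet_space V) (translate psi).

Definition in_all_Lp phi : Prop :=
  forall p : \bar R, (1 <= p)%E -> phi \in Lfun leb p.

Definition bounded_translate_sums phi : Prop :=
  (ereal_sup (range (fun x : R =>
     \esum_(k in [set: int]) `|translate phi k x|%:E)) < +oo)%E.

Definition wavelet_condition phi psi (a' a : R) : Prop :=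
  [/\ scaling_function_and_wavelet phi psi,
      in_all_Lp phi /\ in_all_Lp psi,
      0 < a' < a,
      closed_support (fourier (fun x => (phi x)%:C)) `<=` `[- a, a] /\
      closed_support (fourier (fun x => (psi x)%:C))
        `<=` `[- a, a] `\` `[- a', a'] &
      bounded_translate_sums phi /\ bounded_translate_sums psi].

End wavelets.

Section probability.
Context {R : realType} {d : measure_display} {T : measurableType d}.
Variable P : probability T R.

Definition has_density (X : T -> R) (f : R -> R) : Prop :=
  [/\ measurable_fun [set: R] f, forall x, 0 <= f x &
      forall A : set R, measurable A ->
        P (X @^-1` A) = (\int[@lebesgue_measure R]_(x in A) (f x)%:E)%E].

Definition independent2 (X Y : T -> R) : Prop :=
  forall A B : set R, measurable A -> measurable B ->
    P (X @^-1` A `&` Y @^-1` B) = (P (X @^-1` A) * P (Y @^-1` B))%E.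

Definition mutually_independent (I : finType) (X : I -> T -> R) : Prop :=
  forall (J : {set I}) (B : I -> set R), (forall i, measurable (B i)) ->
    P (\bigcap_(i in [set` J]) X i @^-1` B i) =
    (\prod_(i in J) P (X i @^-1` B i))%E.

End probability.

Section estimator.
Context {R : realType}.
Local Notation leb := (@lebesgue_measure R).
Variables (phi : R -> R) (err : probability R R) (j : R).

(* Outside the support of the numerator the quotient is 0, whether or not
   fourier_measure err vanishes, since x / 0 = 0. *)
Definition phi_tilde (k : int) : R -> R[i] :=
  inv_fourier (fun t =>
    fourier (fun x => (translate phi k x)%:C) (2 `^ (- j) * t) /
    ((2 `^ j)%:C * conjc (fourier_measure err t))).

Definition deconv_kernel (x y : R) : R[i] :=
  (2 `^ j)%:C *
  zcsum (fun k => (phi (2 `^ j * x - k%:~R))%:C * phi_tilde k y).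

(* This is real, as the complex conjugate of phi_tilde k is itself; it is left
   complex-valued, and its deviations are measured by the modulus. *)
Definition estimator (n : nat) (y : 'I_n -> R) (x : R) : R[i] :=
  n%:R^-1 * \sum_(m < n) deconv_kernel x (y m).

Definition sup_deviation {d} {T : measurableType d} (P : probability T R)
    (n : nat) (Y : 'I_n -> T -> R) (w : T) : \bar R :=
  ereal_sup (range (fun x : R =>
    (cabs (estimator (Y ^~ w) x -
           cintegral P (fun w' => estimator (Y ^~ w') x)))%:E)).

(* The infimum is a minimum, as fourier_measure err is continuous. *)
Definition delta (a : R) : R :=
  inf [set cabs (fourier_measure err t) | t in `[- (2 `^ j * a), 2 `^ j * a]].

Definition convolution (f : R -> R) (y : R) : R := \int[err]_x f (y - x).

Definition Linfty_norm (g : R -> R) : R :=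
  fine ('N[leb]_+oo[EFin \o g])%E.

End estimator.

(* Main.v *)
Require Import Defs.
From mathcomp Require Import measurable_realfun ess_sup_inf ring lra.
Set Implicit Arguments.
Unset Strict Implicit.
Unset Printing Implicit Defensive.

Import Order.TTheory GRing.Theory Num.Theory.
Import numFieldNormedType.Exports.
Local Open Scope classical_set_scope.
Local Open Scope ring_scope.

(**
  At a point [x], the deviation of the estimator is
      [2 ^ j * sum_k phi (2 ^ j * x - k) * Z_k],
  where [Z_k] is the mean of [phi_tilde k (Y_m) - E (phi_tilde k (Y_m))] over the
  [n] observations.  The sums of the translates of [|phi|] being bounded by some
  [B], the supremum over [x] is at most [2 ^ j * B * sup_k |Z_k|]
  ([summed_family_deviation]).  A supremum over a continuum thus becomes one over the
  integers; these being infinitely many, the tails of the [Z_k] have to be summable.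

  This rests on two properties of the functions [phi_tilde k].  They are the
  translates by [k * 2 ^ - j] of one inverse Fourier transform, that of a function
  carried by a band of length proportional to [2 ^ j] and bounded by a multiple of
  [2 ^ - j / delta].  On an interval that contains the band, the phases
  [exp (i k 2 ^ - j t)] are orthogonal; hence, by Bessel's inequality, the sum over
  [k] of [|phi_tilde k y| ^ 2] is at most [b ^ 2] for every [y], where
  [b = beta / delta] and [beta] depends on [phi] only ([sum_sqr_phi_tilde]).
  Integrating this bound over one cell of the lattice of the translations shows that
  the integral of [|phi_tilde k| ^ 2] is at most [2 ^ - j * b ^ 2]
  ([integral_sqr_shifted_family]).  As [Y] has the density [g], the variance of
  [phi_tilde k (Y)] is thus at most [G ^ 2 * 2 ^ - j * b ^ 2] for each [k], and
  these variances add up to at most [b ^ 2].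

  Let [S_k = n * Z_k].  Bernstein's argument bounds the expectation of
  [exp (l S_k) + exp (- l S_k) - 2] by [2 t exp t], where [t] is [2 n l ^ 2] times
  the second moment of [phi_tilde k (Y)] ([expR_centered_sum_moment]).  The factor
  [t] makes the sum over [k] finite, and this sum controls [exp (l * sup_k |S_k|)]
  ([expR_sup_centered_sum_moment]).  For a suitable [l], the [exponent], its
  expectation is at most [exp (5 s)] at any level [s] not below [max 1 j]: the
  exponential absorbs the factor [2 ^ j] lost in the summation
  ([exponential_moment_constant]).  Markov's inequality at the level
  [s = (1 + u) * j'] is the tail bound; at [s = j'], comparing powers with
  exponentials gives the moments ([tail_bound], [moment_bound]).

  Finally, the supremum over [x] is measurable because the deviations are Lipschitz
  functions of the observations with a constant that does not depend on [x]
  ([measurable_sup_lipschitz]), and [delta] is positive because the Fourier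
  transform of a probability measure is continuous ([delta_gt0]).
*)

(** * Transferring integrals from sets to functions *)

Section translation.
Context {R : realType}.
Local Notation leb := (@lebesgue_measure R).

Let shift (c : R) : R -> measurableTypeR R := fun x => x + c.

Let measurable_shift c : measurable_fun [set: measurableTypeR R] (shift c).
Proof. by apply: measurable_funD => //; exact: measurable_cst. Qed.

Lemma lebesgue_measure_translation c (A : set R) : measurable A ->
  pushforward leb (shift c) A = leb A.
Proof.
move=> mA.
pose mu : {measure set (measurableTypeR R) -> \bar R} :=
  pushforward leb (shift c).
suff : leb A = mu (measurable_shift c) A by move->.
apply: lebesgue_measure_unique => //= _ [[a b]] _ <-.
rewrite /pushforward /=.
have -> : shift c @^-1` [set` `]a, b]] = [set` `](a - c), (b - c)]].
  by apply/seteqP; split=> x; rewrite /= !in_itv/= /shift ltrBlDr lerBrDr.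
rewrite !lebesgue_measure_itv/= !lte_fin ltrD2r.
by case: ifP => // _; rewrite -!EFinD; congr (_%:E); ring.
Qed.

Lemma ge0_integral_translation (c : R) (f : R -> \bar R) :
  measurable_fun [set: R] f -> (forall x, 0 <= f x)%E ->
  (\int[leb]_x f (x + c)%R = \int[leb]_x f x)%E.
Proof.
move=> mf f0; 
rewrite -(@ge0_integral_pushforward _ _ (measurableTypeR R) (measurableTypeR R)
  R (shift c) (measurable_shift c) leb setT f)//.
by apply: eq_measure_integral => A mA _; exact: lebesgue_measure_translation.
Qed.

Lemma integral_translation (c : R) (f : R -> \bar R) : measurable_fun [set: R] f ->
  (\int[leb]_x f (x + c)%R = \int[leb]_x f x)%E.
Proof.
move=> mf; rewrite integralE [RHS]integralE.
congr (_ - _)%E.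
  have /(_ (funepos_ge0 f)) := @ge0_integral_translation c f^\+%E (measurable_funepos mf).
  by move=> <-; apply: eq_integral => x _; rewrite !funeposE.
have /(_ (funeneg_ge0 f)) := @ge0_integral_translation c f^\-%E (measurable_funeneg mf).
by move=> <-; apply: eq_integral => x _; rewrite !funenegE.
Qed.

End translation.

Section ge0_integral_transfer.
Context {R : realType} {d d' : measure_display} {T : measurableType d}
  {T' : measurableType d'}.
Variables (mu : {measure set T -> \bar R}) (nu : {measure set T' -> \bar R}).
Variables (Y : T -> T') (r : T -> R) (c : R).
Hypotheses (mY : measurable_fun setT Y) (mr : measurable_fun setT r).
Hypotheses (r0 : forall w, 0 <= r w) (c0 : 0 <= c).
Hypothesis muE : forall B, measurable B ->
  (\int[mu]_w (\1_B (Y w) * r w)%:E = c%:E * nu B)%E.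

Import HBNNSimple.

(** Both sides are additive and continuous along increasing sequences in [g], so
    agreement on indicators propagates to nonnegative functions.  The weight [r]
    lets one statement serve both for densities, where [Y] is the identity, and
    for independence, where [r] is the product of the factors other than
    [g (Y w)]. *)
Lemma ge0_integral_transfer (g : T' -> R) : measurable_fun setT g ->
  (forall y, 0 <= g y) ->
  (\int[mu]_w (g (Y w) * r w)%:E = c%:E * \int[nu]_y (g y)%:E)%E.
Proof.
move=> mg g0.
have mEg : measurable_fun setT (EFin \o g) by exact/measurable_EFinP.
pose g_ := nnsfun_approx measurableT mEg.
have mgr n : measurable_fun setT (fun w => g_ n (Y w) * r w).
  by apply: measurable_funM => //; exact: measurableT_comp.
have cg y : (g_ n y)%:E @[n --> \oo] --> (g y)%:E.
  by apply: (cvg_nnsfun_approx measurableT mEg) => // x _; rewrite lee_fin.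
have cg' y : g_ n y @[n --> \oo] --> g y by have /fine_cvgP[_] := cg y.
have ndg y : {homo (fun n => g_ n y) : m n / (m <= n)%N >-> m <= n}.
  by move=> m n mn; exact/lefP/nd_nnsfun_approx.
transitivity (limn (fun n => \int[mu]_w (g_ n (Y w) * r w)%:E)%E).
  rewrite -monotone_convergence//.
  - apply: eq_integral => w _; apply/esym/cvg_lim => //.
    by apply: cvg_EFin; [exact: nearW|apply: cvgM; [exact: cg'|exact: cvg_cst]].
  - by move=> n; exact/measurable_EFinP.
  - by move=> n w _; rewrite lee_fin mulr_ge0.
  - by move=> w _ m n mn; rewrite lee_fin ler_wpM2r// ndg.
transitivity (limn (fun n => c%:E * \int[nu]_y (g_ n y)%:E)%E); last first.
  rewrite [in RHS](_ : (fun y => _) = fun y => limn (fun n => (g_ n y)%:E)); last first.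
    by apply/funext => y; apply/esym/cvg_lim => //; exact: cg.
  rewrite monotone_convergence//; last 3 first.
  - by move=> n; exact/measurable_EFinP.
  - by move=> n w _; rewrite lee_fin.
  - by move=> w _ m n mn; rewrite lee_fin ndg.
  apply: limeMl => //; apply: ereal_nondecreasing_is_cvgn => m n mn.
  apply: ge0_le_integral => //.
  - by move=> x _; rewrite lee_fin.
  - exact/measurable_EFinP.
  - exact/measurable_EFinP.
  - by move=> x _; rewrite lee_fin ndg.
apply: congr_lim; apply/funext => n.
have mI k : measurable_fun setT (fun w => \1_(g_ n @^-1` [set k]) (Y w) : R).
  by apply: measurableT_comp => //; exact: measurable_indic.
transitivity (\sum_(k \in range (g_ n))
    \int[mu]_w (k * (\1_(g_ n @^-1` [set k]) (Y w) * r w))%:E)%E.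
  rewrite -ge0_integral_fsum//.
  - apply: eq_integral => w _; rewrite fsumEFin// fimfunE; congr (_%:E).
    rewrite mulr_fsuml; apply: eq_fsbigr => k _; exact: esym (mulrA _ _ _).
  - move=> k; apply/measurable_EFinP; apply: measurable_funM => //.
    exact: measurable_funM.
  - move=> k w _; rewrite lee_fin mulrA mulr_ge0//.
    exact: nnfun_muleindic_ge0.
transitivity (\sum_(k \in range (g_ n)) (c%:E * (k%:E * nu (g_ n @^-1` [set k]))))%E.
  apply: eq_fsbigr => k; rewrite inE => -[y _ <-].
  under eq_integral do rewrite EFinM.
  rewrite ge0_integralZl//; last 3 first.
  - by apply/measurable_EFinP; exact: measurable_funM.
  - by move=> w _; rewrite lee_fin mulr_ge0.
  - by rewrite lee_fin.
  by rewrite muE// muleCA.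
rewrite -ge0_mule_fsumr//; last by move=> k; exact: nnsfun_mulemu_ge0.
by rewrite -sintegralE integralT_nnsfun.
Qed.

End ge0_integral_transfer.

(** * Independence *)

Section independence.
Context {R : realType} {d : measure_display} {T : measurableType d}
  {P : probability T R} {I : finType}.
Variable Y : I -> {RV P >-> R}.
Hypothesis indepY : mutually_independent P (fun i => Y i : T -> R).

Lemma ge0_bounded_expectation_fin_num (h : T -> R) (M : R) :
  measurable_fun setT h -> (forall w, 0 <= h w <= M) ->
  (\int[P]_w (h w)%:E)%E \is a fin_num.
Proof.
move=> mh h0; rewrite ge0_fin_numE; last first.
  by apply: integral_ge0 => w _; rewrite lee_fin; have /andP[] := h0 w.
apply: (@le_lt_trans _ _ (\int[P]_w M%:E)%E).
  apply: ge0_le_integral => //.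
  - by move=> w _; rewrite lee_fin; have /andP[] := h0 w.
  - exact/measurable_EFinP.
  - by move=> w _; rewrite lee_fin; have /andP[] := h0 w.
by rewrite integral_cst//= probability_setT mule1 ltry.
Qed.

(** Independence is a product rule for events, that is, for indicators; these are
    traded for the functions [psi i] one index at a time. *)
Lemma expectation_prod_independent (psi : I -> R -> R) (M : R) :
  (forall i, measurable_fun setT (psi i)) -> (forall i y, 0 <= psi i y <= M) ->
  (\int[P]_w (\prod_i psi i (Y i w))%:E =
   \prod_i \int[P]_w (psi i (Y i w))%:E)%E.
Proof.
move=> mpsi psiM.
have psi0 i y : 0 <= psi i y by have /andP[] := psiM i y.
pose e i := fine (\int[P]_w (psi i (Y i w))%:E).
have eE i : (\int[P]_w (psi i (Y i w))%:E = (e i)%:E)%E.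
  rewrite fineK//; apply: (@ge0_bounded_expectation_fin_num _ M) => //.
  exact: measurableT_comp.
pose p i B := fine (P (Y i @^-1` B)).
have mpre i B : measurable B -> measurable (Y i @^-1` B).
  by move=> mB; rewrite -[X in measurable X]setTI; exact: measurable_funP.
have pE i B : measurable B -> P (Y i @^-1` B) = (p i B)%:E.
  by move=> mB; rewrite fineK// fin_num_measure//; exact: mpre.
have p0 i B : measurable B -> 0 <= p i B.
  by move=> mB; rewrite -lee_fin -pE// measure_ge0.
have e0 i : 0 <= e i by rewrite -lee_fin -eE integral_ge0// => w _; rewrite lee_fin.
suff H (s : seq I) (B : I -> set R) : (forall i, measurable (B i)) ->
    (\int[P]_w (\prod_i (if i \in s then psi i (Y i w) else \1_(B i) (Y i w)))%:E =
     (\prod_i (if i \in s then e i else p i (B i)))%:E)%E.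
  have := H (enum I) (fun=> setT) (fun=> measurableT).
  under eq_integral do under eq_bigr do rewrite mem_enum/=.
  move=> ->; rewrite -prodEFin; apply: eq_bigr => i _.
  by rewrite mem_enum/= eE.
elim: s B => [|i0 s IH] B mB.
  transitivity (P (\bigcap_(i in [set` [set: I]%SET]) Y i @^-1` B i)).
    have mcap : measurable (\bigcap_(i in [set` [set: I]%SET]) Y i @^-1` B i).
      by apply: fin_bigcap_measurable => // i _; exact: mpre.
    rewrite -[X in _ = P X]setIT -integral_indic//; apply: eq_integral => w _; congr (_%:E).
    rewrite indicE; case: (boolP (w \in _)).
      rewrite inE => wB; rewrite big1// => i _; rewrite indicE mem_set//.
      by apply: wB => /=; rewrite inE.
    move=> /negP wB; apply/eqP/prodf_eq0; apply: contrapT => nex; apply: wB.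
    rewrite inE => i _ /=; apply: contrapT => nB; apply: nex; exists i => //.
    by rewrite indicE memNset.
  rewrite indepY// -prodEFin big_mkcond/=; apply: eq_bigr => i _.
  by rewrite inE pE.
have [i0s|i0s] := boolP (i0 \in s).
  have E i : (i \in i0 :: s) = (i \in s).
    by rewrite inE; case: eqP => // ->; rewrite i0s.
  under eq_integral do under eq_bigr do rewrite E.
  by rewrite IH//; congr (_%:E); apply: eq_bigr => i _; rewrite E.
pose F i w := if i \in s then psi i (Y i w) else \1_(B i) (Y i w).
pose E i := if i \in s then e i else p i (B i).
have mF i : measurable_fun setT (F i).
  rewrite /F; case: (i \in s); first exact: measurableT_comp.
  by apply: measurableT_comp => //; exact: measurable_indic.
pose r w := \prod_(i | i != i0) F i w.
pose c := \prod_(i | i != i0) E i.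
have F0 i w : 0 <= F i w by rewrite /F; case: ifP.
have Nin i : i != i0 -> (i \in i0 :: s) = (i \in s) by rewrite inE => /negPf->.
transitivity (\int[P]_w (psi i0 (Y i0 w) * r w)%:E)%E.
  apply: eq_integral => w _; congr (_%:E); rewrite (bigD1 i0)//= mem_head; congr (_ * _).
  by apply: eq_bigr => i /Nin ->.
rewrite (@ge0_integral_transfer _ _ _ _ _ P (distribution P (Y i0)) (Y i0) r c)//.
- rewrite (bigD1 i0)//= mem_head EFinM -eE muleC; congr (_ * _)%E.
    rewrite ge0_integral_distribution//; first exact/measurable_EFinP.
    by move=> y; rewrite lee_fin.
  by congr (_%:E); apply: eq_bigr => i /Nin ->.
- have -> : r = fun w => \prod_(i <- [seq i <- index_enum I | i != i0]) F i w.
    by apply/funext => w; rewrite big_filter.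
  by apply: measurable_prod => i _; exact: mF.
- by move=> w; rewrite /r; apply: prodr_ge0.
- move=> C mC.
  have mB' i : measurable (if i == i0 then C else B i) by case: ifP.
  have := IH (fun i => if i == i0 then C else B i) mB'.
  rewrite [in RHS](bigD1 i0)//= (negPf i0s) eqxx.
  rewrite [X in _ = (_ * X)%:E](_ : _ = c); last first.
    by apply: eq_bigr => i /negPf ->.
  rewrite EFinM -pE// muleC => <-.
  apply: eq_integral => w _; congr (_%:E).
  rewrite (bigD1 i0)//= (negPf i0s) eqxx; congr (_ * _).
  by apply: eq_bigr => i /negPf i0i; rewrite i0i.
Qed.

End independence.

(** * Exponential moments of centred sums *)

Section bounded_integrals.
Context {R : realType} {d : measure_display} {T : measurableType d}.
Variable P : probability T R.

Lemma bounded_integrable (h : T -> R) (b : R) : measurable_fun setT h ->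
  (forall w, `|h w| <= b) -> P.-integrable setT (EFin \o h).
Proof.
move=> mh hb; apply: measurable_bounded_integrable => //.
  by rewrite (@le_lt_trans _ _ 1%E) ?probability_le1 ?ltry.
exists b; split; first exact: num_real.
by move=> M bM w _ /=; rewrite (le_trans (hb w))// ltW.
Qed.

Lemma Rintegral_probability_cst (c : R) : \int[P]_w c = c.
Proof. by rewrite Rintegral_cst//= probability_setT mulr1. Qed.

Lemma normr_Rintegral_bounded (h : T -> R) (b : R) : measurable_fun setT h ->
  (forall w, `|h w| <= b) -> `|\int[P]_w h w| <= b.
Proof.
move=> mh hb; have ih := bounded_integrable mh hb.
rewrite (le_trans (le_normr_Rintegral _ ih))//.
rewrite -[leRHS]Rintegral_probability_cst; apply: le_Rintegral => //.
- exact: integrable_norm.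
- by apply: (@bounded_integrable _ `|b|) => //; exact: measurable_cst.
Qed.

End bounded_integrals.

Section exponential_moment.
Context {R : realType}.

(** Squaring the inequality [1 - x / 2 <= expR (- (x / 2))] bounds [expR x] by a
    rational function; after clearing its denominator, the difference of the two
    sides is a product of factors that are nonnegative for [x <= 1]. *)
Lemma expR_le_quadratic (x : R) : x <= 1 -> expR x <= 1 + x + 2 * x ^+ 2.
Proof.
move=> x1; have E := expR_ge1Dx (- (x / 2)).
have x2 : 0 < 1 - x / 2 by lra.
have -> : expR x = (expR (- (x / 2)) ^+ 2)^-1.
  by rewrite -expRM_natl -expRN; congr expR; field.
have p : (1 - x / 2) ^+ 2 <= expR (- (x / 2)) ^+ 2.
  by rewrite lerXn2r ?nnegrE ?expR_ge0// ltW.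
apply: (@le_trans _ _ ((1 - x / 2) ^+ 2)^-1).
  by rewrite lef_pV2 ?posrE ?exprn_gt0 ?expR_gt0.
rewrite -[leLHS]mul1r ler_pdivrMr ?exprn_gt0//.
rewrite -subr_ge0 (_ : _ - _ = x ^+ 2 * ((1 - x) * (5 / 2 - x)) / 2); last by field.
by rewrite divr_ge0// mulr_ge0 ?sqr_ge0// mulr_ge0; lra.
Qed.

Lemma expR_norm_le (x : R) : expR `|x| <= expR x + expR (- x).
Proof. by case: (ger0P x) => _; rewrite ?lerDl ?lerDr expR_ge0. Qed.

Lemma expRD_expRN_ge2 (x : R) : 2 <= expR x + expR (- x).
Proof. by have := expR_ge1Dx x; have := expR_ge1Dx (- x); lra. Qed.

Lemma expRB1_le (t c : R) : 0 <= t <= c -> expR t - 1 <= t * expR c.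
Proof.
move=> /andP[t0 tc]; apply: (@le_trans _ _ (t * expR t)); last first.
  by rewrite ler_wpM2l// ler_expR.
have := expR_ge1Dx (- t); rewrite expRN => E.
have et := expR_gt0 t.
rewrite -(ler_pM2r (x := (expR t)^-1)) ?invr_gt0// mulrBl mul1r -mulrA divff ?gt_eqF//.
lra.
Qed.

Context {d : measure_display} {T : measurableType d} {P : probability T R}.
Context {I : finType}.
Variables (Y : I -> {RV P >-> R}) (mu : probability R R).
Hypothesis indepY : mutually_independent P (fun i => Y i : T -> R).
Hypothesis lawY : forall i (A : set R), measurable A -> distribution P (Y i) A = mu A.

Lemma ge0_integral_common_law i (g : R -> R) : measurable_fun setT g ->
  (forall y, 0 <= g y) ->
  (\int[P]_w (g (Y i w))%:E = \int[mu]_y (g y)%:E)%E.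
Proof.
move=> mg g0; transitivity (\int[distribution P (Y i)]_y (g y)%:E)%E.
  by rewrite ge0_integral_distribution//; exact/measurable_EFinP.
by apply: eq_measure_integral => A mA _; exact: lawY.
Qed.

(** Bernstein's argument: the linear term integrates to 0, which leaves the second
    moment alone in the exponent. *)
Lemma expR_centered_moment (h : R -> R) (b l : R) : measurable_fun setT h ->
  (forall y, `|h y| <= b) -> 2 * (`|l| * b) <= 1 ->
  (\int[mu]_y (expR (l * (h y - \int[mu]_z h z)))%:E <=
   (expR (2 * l ^+ 2 * \int[mu]_z (h z ^+ 2)))%:E)%E.
Proof.
move=> mh hb lb; set e := \int[mu]_z h z; set v := \int[mu]_z (h z ^+ 2).
have eb : `|e| <= b by exact: normr_Rintegral_bounded.
have mh2 : measurable_fun setT (fun y => h y ^+ 2) by exact: measurable_funX.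
have ih := bounded_integrable mu mh hb.
have ih2 : mu.-integrable setT (EFin \o (fun y => h y ^+ 2)).
  apply: (@bounded_integrable _ _ _ _ _ (b ^+ 2)) => // y.
  by rewrite normrX lerXn2r ?nnegrE// (le_trans _ (hb y)).
pose A := 1 - l * e + 2 * l ^+ 2 * e ^+ 2.
pose B := l - 4 * l ^+ 2 * e.
have iB : mu.-integrable setT (EFin \o (fun y => B * h y)).
  by have := integrableZl measurableT B ih; apply: eq_integrable.
have i2 : mu.-integrable setT (EFin \o (fun y => 2 * l ^+ 2 * h y ^+ 2)).
  by have := integrableZl measurableT (2 * l ^+ 2) ih2; apply: eq_integrable.
have iA : mu.-integrable setT (EFin \o (fun _ : R => A)).
  by apply: (@bounded_integrable _ _ _ _ _ `|A|).
have iAB : mu.-integrable setT (EFin \o (fun y => A + B * h y)).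
  by have := integrableD measurableT iA iB; apply: eq_integrable.
have iQ : mu.-integrable setT (EFin \o (fun y => A + B * h y + 2 * l ^+ 2 * h y ^+ 2)).
  by have := integrableD measurableT iAB i2; apply: eq_integrable.
apply: (@le_trans _ _ (\int[mu]_y (A + B * h y + 2 * l ^+ 2 * h y ^+ 2)%:E)%E).
  apply: ge0_le_integral => //.
  - apply/measurable_EFinP; apply: measurableT_comp => //.
    apply: measurable_funM => //; exact: measurable_funB.
  - exact: measurable_int iQ.
  - move=> y _; rewrite lee_fin.
    rewrite [leRHS](_ : _ = 1 + l * (h y - e) + 2 * (l * (h y - e)) ^+ 2); last first.
      by rewrite /A /B; ring.
    apply: expR_le_quadratic; rewrite (le_trans (ler_norm _))// normrM.
    rewrite (le_trans _ lb)// [leRHS]mulrCA ler_wpM2l//.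
    by rewrite (le_trans (ler_normB _ _))// mulr_natl mulr2n lerD.
have -> : (\int[mu]_y (A + B * h y + 2 * l ^+ 2 * h y ^+ 2)%:E =
    (\int[mu]_y (A + B * h y + 2 * l ^+ 2 * h y ^+ 2))%:E)%E.
  by rewrite fineK//; exact: integrable_fin_num.
rewrite lee_fin RintegralD// RintegralD// !RintegralZl// Rintegral_probability_cst.
rewrite -/e -/v (le_trans _ (expR_ge1Dx _))// -subr_ge0.
rewrite (_ : _ - _ = 2 * (l * e) ^+ 2); last by rewrite /A /B; ring.
by rewrite mulr_ge0// sqr_ge0.
Qed.

Lemma expR_centered_sum_moment (h : R -> R) (b l : R) : measurable_fun setT h ->
  (forall y, `|h y| <= b) -> 2 * (`|l| * b) <= 1 ->
  (\int[P]_w (expR (l * \sum_i (h (Y i w) - \int[mu]_z h z)))%:E <=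
   (expR (2 * l ^+ 2 * #|I|%:R * \int[mu]_z (h z ^+ 2)))%:E)%E.
Proof.
move=> mh hb lb; set e := \int[mu]_z h z.
have eb : `|e| <= b by exact: normr_Rintegral_bounded.
pose psi (i : I) y := expR (l * (h y - e)).
have mpsi i : measurable_fun setT (psi i).
  apply: measurableT_comp => //; apply: measurable_funM => //.
  exact: measurable_funB.
under eq_integral do rewrite mulr_sumr expR_sum.
rewrite (@expectation_prod_independent _ _ _ _ _ Y indepY psi (expR 1))//; last first.
  move=> i y; rewrite expR_ge0 ler_expR (le_trans (ler_norm _))// normrM.
  rewrite (le_trans _ lb)// [leRHS]mulrCA ler_wpM2l//.
  by rewrite (le_trans (ler_normB _ _))// mulr_natl mulr2n lerD.
rewrite (eq_bigr (fun=> \int[mu]_y (expR (l * (h y - e)))%:E)%E); last first.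
  by move=> i _; rewrite (@ge0_integral_common_law i (psi i))// => y; rewrite expR_ge0.
have := expR_centered_moment mh hb lb; rewrite -/e.
have : (0 <= \int[mu]_y (expR (l * (h y - e)))%:E)%E by exact: integral_ge0.
case: (\int[mu]_y _)%E => [m||]// m0; rewrite !lee_fin => mle.
rewrite prodEFin lee_fin prodr_const mulrAC mulrC expRM_natl lerXn2r//.
by rewrite nnegrE expR_ge0.
Qed.


Let S (h : R -> R) w := \sum_i (h (Y i w) - \int[mu]_z h z).

Lemma measurable_centered_sum (h : R -> R) : measurable_fun setT h ->
  measurable_fun setT (S h).
Proof.
move=> mh; apply: measurable_sum => i; apply: measurable_funB => //.
exact: measurableT_comp.
Qed.

(** The function [expR x + expR (- x) - 2] vanishes to the second order at 0, so its
    expectation at [l * S (h k)] is at most a multiple of the second moment of [h k].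
    As all these second moments add up to [b ^+ 2] at most, infinitely many
    functions are handled at the price of a single factor. *)
Lemma expR_sup_centered_sum_moment (h : nat -> R -> R) (b s2 l : R) :
  (forall k, measurable_fun setT (h k)) -> 0 <= b ->
  (forall N y, \sum_(k < N) (h k y) ^+ 2 <= b ^+ 2) ->
  (forall k, \int[mu]_y (h k y ^+ 2) <= s2) ->
  0 <= l -> 2 * (l * b) <= 1 ->
  (\int[P]_w (2 + \sum_(k <oo) (expR (l * S (h k) w) + expR (- (l * S (h k) w)) - 2)%:E) <=
   (2 + 4 * l ^+ 2 * #|I|%:R * b ^+ 2 * expR (2 * l ^+ 2 * #|I|%:R * s2))%:E)%E.
Proof.
move=> mh b0 hb vs l0 lb.
have hb1 k y : `|h k y| <= b.
  rewrite -(ler_pXn2r (n := 2))// ?nnegrE// real_normK ?num_real//.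
  apply: le_trans (hb k.+1 y); rewrite big_ord_recr/= lerDr.
  by apply: sumr_ge0 => i _; exact: sqr_ge0.
have mh2 k : measurable_fun setT (fun y => h k y ^+ 2) by exact: measurable_funX.
have ih2 k : mu.-integrable setT (EFin \o (fun y => h k y ^+ 2)).
  apply: (@bounded_integrable _ _ _ _ _ (b ^+ 2)) => // y.
  by rewrite normrX lerXn2r ?nnegrE.
pose v k := \int[mu]_y (h k y ^+ 2).
have v0 k : 0 <= v k by apply: Rintegral_ge0 => y _; exact: sqr_ge0.
have vE k : (v k)%:E = (\int[mu]_y (h k y ^+ 2)%:E)%E.
  by rewrite /v /Rintegral fineK//; have := integrable_fin_num measurableT (ih2 k).
have sv N : \sum_(k < N) v k <= b ^+ 2.
  rewrite -lee_fin -sumEFin (eq_bigr _ (fun (k : 'I_N) _ => vE k)).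
  rewrite -ge0_integral_sum//; last 2 first.
  - by move=> k; exact/measurable_EFinP.
  - by move=> k y _; rewrite lee_fin sqr_ge0.
  apply: (@le_trans _ _ (\int[mu]_y (b ^+ 2)%:E)%E); last first.
    by rewrite integral_cst//= probability_setT mule1.
  apply: ge0_le_integral => //.
  - by move=> y _; apply: sume_ge0 => k _; rewrite lee_fin sqr_ge0.
  - by apply: emeasurable_sum => k; exact/measurable_EFinP.
  - by move=> y _; rewrite sumEFin lee_fin; exact: hb.
pose q k w := expR (l * S (h k) w) + expR (- (l * S (h k) w)) - 2.
have q0 k w : 0 <= q k w by rewrite subr_ge0 expRD_expRN_ge2.
have mS k : measurable_fun setT (fun w => l * S (h k) w).
  by apply: measurable_funM => //; exact: measurable_centered_sum.
have mq k : measurable_fun setT (fun w => (q k w)%:E).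
  apply/measurable_EFinP; apply: measurable_funB => //.
  apply: measurable_funD; first exact: measurableT_comp.
  by apply: measurableT_comp => //; exact: measurable_funN.
pose n : R := #|I|%:R; have n0 : 0 <= n by rewrite /n.
pose t k := 2 * l ^+ 2 * n * v k.
have t0 k : 0 <= t k by rewrite /t !mulr_ge0 ?sqr_ge0.
have qle k : (\int[P]_w (q k w)%:E <= (2 * (t k * expR (2 * l ^+ 2 * n * s2)))%:E)%E.
  have Ep : (\int[P]_w (expR (l * S (h k) w))%:E <= (expR (t k))%:E)%E.
    by apply: (expR_centered_sum_moment (mh k) (hb1 k)); rewrite ger0_norm.
  have En : (\int[P]_w (expR (- (l * S (h k) w)))%:E <= (expR (t k))%:E)%E.
    under eq_integral do rewrite -mulNr.
    have := expR_centered_sum_moment (l := - l) (mh k) (hb1 k).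
    by rewrite normrN sqrrN ger0_norm//; exact.
  have E2 : (\int[P]_w (q k w)%:E + 2%:E <= (expR (t k) + expR (t k))%:E)%E.
    have -> : 2%:E = (\int[P]_w 2%:E)%E :> \bar R.
      by rewrite integral_cst//= probability_setT mule1.
    rewrite -ge0_integralD//; last by move=> w _; rewrite lee_fin.
    under eq_integral do rewrite -EFinD /q subrK EFinD.
    rewrite ge0_integralD//; last 2 first.
    - by apply/measurable_EFinP; exact: measurableT_comp.
    - apply/measurable_EFinP; apply: measurableT_comp => //; exact: measurable_funN.
    by rewrite EFinD leeD.
  have -> : (\int[P]_w (q k w)%:E = \int[P]_w (q k w)%:E + 2%:E - 2%:E)%E.
    by rewrite addeK.
  rewrite leeBlDr//; apply: (le_trans E2); rewrite -EFinD lee_fin.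
  have : expR (t k) - 1 <= t k * expR (2 * l ^+ 2 * n * s2).
    by apply: expRB1_le; rewrite t0/= ler_wpM2l// ?mulr_ge0 ?sqr_ge0//; exact: vs.
  by set X := t k * _; lra.
change (\int[P]_w (2 + \sum_(k <oo) (q k w)%:E) <=
  (2 + 4 * l ^+ 2 * n * b ^+ 2 * expR (2 * l ^+ 2 * n * s2))%:E)%E.
rewrite ge0_integralD//; last 2 first.
- by move=> w _; apply: nneseries_ge0 => k _ _; rewrite lee_fin.
- apply: (@ge0_emeasurable_sum _ _ _ _ (fun k w => (q k w)%:E) xpredT) => //.
  by move=> k w _ _; rewrite lee_fin.
rewrite integral_cst//= probability_setT mule1 [leRHS]EFinD; apply: leeD => //.
rewrite integral_nneseries//; last by move=> k w _; rewrite lee_fin.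
apply: lime_le.
  by apply: is_cvg_nneseries => k _ _; apply: integral_ge0 => w _; rewrite lee_fin.
near=> N; rewrite big_mkord.
apply: (@le_trans _ _ (\sum_(k < N) (2 * (t k * expR (2 * l ^+ 2 * n * s2)))%:E)%E).
  by apply: lee_sum => k _; exact: qle.
rewrite sumEFin lee_fin.
set E := expR _; have E0 : 0 <= E by exact: expR_ge0.
have -> : \sum_(k < N) 2 * (t k * E) = 4 * l ^+ 2 * n * E * \sum_(k < N) v k.
  by rewrite mulr_sumr; apply: eq_bigr => k _; rewrite /t; ring.
by rewrite [leRHS]mulrAC ler_wpM2l// !mulr_ge0// sqr_ge0.
Unshelve. all: by end_near. Qed.

End exponential_moment.

(** * Bessel's inequality for oscillating phases *)

Section bounded_measurable.
Context {R : realType} {d : measure_display} {T : measurableType d}.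

(** These functions form a ring and are integrable on every set of finite measure,
    which settles the integrability of all the trigonometric expressions that
    follow. *)
Definition bounded_measurable (f : T -> R) :=
  measurable_fun setT f /\ exists M, forall x, `|f x| <= M.

Lemma bounded_measurable_cst (c : R) : bounded_measurable (fun=> c).
Proof. by split; [exact: measurable_cst|exists `|c|]. Qed.

Lemma bounded_measurableD f g : bounded_measurable f -> bounded_measurable g ->
  bounded_measurable (fun x => f x + g x).
Proof.
move=> [mf [M fM]] [mg [N gN]]; split; first exact: measurable_funD.
by exists (M + N) => x; rewrite (le_trans (ler_normD _ _))// lerD.
Qed.

Lemma bounded_measurableM f g : bounded_measurable f -> bounded_measurable g ->
  bounded_measurable (fun x => f x * g x).
Proof.
move=> [mf [M fM]] [mg [N gN]]; split; first exact: measurable_funM.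
by exists (M * N) => x; rewrite normrM ler_pM.
Qed.

Lemma bounded_measurableN f : bounded_measurable f -> bounded_measurable (fun x => - f x).
Proof.
move=> [mf [M fM]]; split; first exact: measurable_funN.
by exists M => x; rewrite normrN.
Qed.

Lemma bounded_measurableB f g : bounded_measurable f -> bounded_measurable g ->
  bounded_measurable (fun x => f x - g x).
Proof. by move=> bf bg; apply: bounded_measurableD => //; exact: bounded_measurableN. Qed.

Lemma bounded_measurable_sum (I : Type) (s : seq I) (F : I -> T -> R) :
  (forall i, bounded_measurable (F i)) ->
  bounded_measurable (fun x => \sum_(i <- s) F i x).
Proof.
move=> bF; elim: s => [|i s IH].
  by under eq_fun do rewrite big_nil; exact: bounded_measurable_cst.
by under eq_fun do rewrite big_cons; exact: bounded_measurableD.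
Qed.

Lemma bounded_measurable_cos f : measurable_fun setT f ->
  bounded_measurable (fun x => cos (f x)).
Proof.
move=> mf; split; last by exists 1 => x; exact: cos_max.
apply: measurableT_comp mf; apply: continuous_measurable_fun; exact: continuous_cos.
Qed.

Lemma bounded_measurable_sin f : measurable_fun setT f ->
  bounded_measurable (fun x => sin (f x)).
Proof.
move=> mf; split; last by exists 1 => x; exact: sin_max.
apply: measurableT_comp mf; apply: continuous_measurable_fun; exact: continuous_sin.
Qed.

Variables (mu : {measure set T -> \bar R}) (D : set T).
Hypotheses (mD : measurable D) (muD : (mu D < +oo)%E).

Lemma bounded_measurable_integrable f : bounded_measurable f ->
  mu.-integrable D (EFin \o f).
Proof.
move=> [mf [M fM]]; apply: measurable_bounded_integrable => //.
  exact: measurable_funTS.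
exists M; split; first exact: num_real.
by move=> M' MM' w _ /=; rewrite (le_trans (fM w))// ltW.
Qed.

Lemma bounded_RintegralD f g : bounded_measurable f -> bounded_measurable g ->
  \int[mu]_(x in D) (f x + g x) = \int[mu]_(x in D) f x + \int[mu]_(x in D) g x.
Proof. by move=> bf bg; rewrite RintegralD//; exact: bounded_measurable_integrable. Qed.

Lemma bounded_RintegralB f g : bounded_measurable f -> bounded_measurable g ->
  \int[mu]_(x in D) (f x - g x) = \int[mu]_(x in D) f x - \int[mu]_(x in D) g x.
Proof. by move=> bf bg; rewrite RintegralB//; exact: bounded_measurable_integrable. Qed.

Lemma bounded_RintegralZ c f : bounded_measurable f ->
  \int[mu]_(x in D) (c * f x) = c * \int[mu]_(x in D) f x.
Proof. by move=> bf; rewrite RintegralZl//; exact: bounded_measurable_integrable. Qed.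

Lemma bounded_Rintegral_sum (I : Type) (s : seq I) (F : I -> T -> R) :
  (forall i, bounded_measurable (F i)) ->
  \int[mu]_(x in D) (\sum_(i <- s) F i x) = \sum_(i <- s) \int[mu]_(x in D) F i x.
Proof.
move=> bF; elim: s => [|i s IH].
  rewrite big_nil; under eq_Rintegral do rewrite big_nil.
  by rewrite Rintegral_cst// mul0r.
rewrite big_cons -IH -bounded_RintegralD//; last exact: bounded_measurable_sum.
by apply: eq_Rintegral => x _; rewrite big_cons.
Qed.

Lemma normr_bounded_Rintegral f M : bounded_measurable f ->
  (forall x, D x -> `|f x| <= M) ->
  `|\int[mu]_(x in D) f x| <= M * fine (mu D).
Proof.
move=> bf fM; have intf := bounded_measurable_integrable bf.
rewrite (le_trans (le_normr_Rintegral _ intf))// -Rintegral_cst//.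
apply: le_Rintegral => //; first exact: integrable_norm.
exact: bounded_measurable_integrable (bounded_measurable_cst M).
Qed.

Section bessel.
Variables (u1 u2 : T -> R) (theta : int -> T -> R) (W : R).
Hypotheses (bu1 : bounded_measurable u1) (bu2 : bounded_measurable u2).
Hypothesis mtheta : forall k, measurable_fun setT (theta k).
Hypothesis intcos : forall k l,
  \int[mu]_(x in D) cos (theta k x - theta l x) = W * (k == l)%:R.
Hypothesis intsin : forall k l,
  \int[mu]_(x in D) sin (theta k x - theta l x) = 0.

Let A k := \int[mu]_(x in D) (u1 x * cos (theta k x) - u2 x * sin (theta k x)).
Let B k := \int[mu]_(x in D) (u1 x * sin (theta k x) + u2 x * cos (theta k x)).

(** [A k] and [B k] are the real and imaginary parts of the integral of
    [(u1 + i u2) exp (i theta k)].  The inequality says that the integral of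
    [|W u - p| ^ 2] is nonnegative for the trigonometric polynomial [p] that has
    these numbers as its coefficients. *)
Lemma bessel_inequality (s : seq int) : uniq s -> 0 < W ->
  \sum_(k <- s) (A k ^+ 2 + B k ^+ 2) <=
  W * \int[mu]_(x in D) (u1 x ^+ 2 + u2 x ^+ 2).
Proof.
move=> us W0; pose S := \sum_(k <- s) (A k ^+ 2 + B k ^+ 2).
have bc k := bounded_measurable_cos (mtheta k).
have bs k := bounded_measurable_sin (mtheta k).
have mth k l : measurable_fun setT (fun x => theta k x - theta l x).
  exact: measurable_funB.
have bcd k l := bounded_measurable_cos (mth k l).
have bsd k l := bounded_measurable_sin (mth k l).
have bC c := bounded_measurable_cst c.
pose p1 x := \sum_(k <- s) (A k * cos (theta k x) + B k * sin (theta k x)).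
pose p2 x := \sum_(k <- s) (B k * cos (theta k x) - A k * sin (theta k x)).
have b1 : bounded_measurable p1.
  by apply: bounded_measurable_sum => k; apply: bounded_measurableD;
    apply: bounded_measurableM.
have b2 : bounded_measurable p2.
  by apply: bounded_measurable_sum => k; apply: bounded_measurableB;
    apply: bounded_measurableM.
(* The coefficients are real linear combinations of integrals, so that pairing
   [u] with [p] gives back the sum of their squares. *)
have cross : \int[mu]_(x in D) (u1 x * p1 x + u2 x * p2 x) = S.
  transitivity (\int[mu]_(x in D) (\sum_(k <- s)
     (A k * (u1 x * cos (theta k x) - u2 x * sin (theta k x)) +
      B k * (u1 x * sin (theta k x) + u2 x * cos (theta k x))))).
    apply: eq_Rintegral => x _; rewrite /p1 /p2 !mulr_sumr -big_split/=.
    by apply: eq_bigr => k _; ring.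
  rewrite bounded_Rintegral_sum; last first.
    by move=> k; apply: bounded_measurableD; apply: bounded_measurableM => //;
      [apply: bounded_measurableB|apply: bounded_measurableD]; apply: bounded_measurableM.
  apply: eq_bigr => k _; rewrite bounded_RintegralD; last 2 first.
  - by apply: bounded_measurableM => //; apply: bounded_measurableB;
      apply: bounded_measurableM.
  - by apply: bounded_measurableM => //; apply: bounded_measurableD;
      apply: bounded_measurableM.
  rewrite !bounded_RintegralZ; last 2 first.
  - by apply: bounded_measurableD; apply: bounded_measurableM.
  - by apply: bounded_measurableB; apply: bounded_measurableM.
  by rewrite !expr2.
(* By orthogonality, only the diagonal terms survive. *)
have norm : \int[mu]_(x in D) (p1 x * p1 x + p2 x * p2 x) = W * S.
  pose F k l x := (A k * A l + B k * B l) * cos (theta k x - theta l x) +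
      (B k * A l - A k * B l) * sin (theta k x - theta l x).
  have bF k l : bounded_measurable (F k l) by apply: bounded_measurableD;
    apply: bounded_measurableM.
  transitivity (\int[mu]_(x in D) (\sum_(k <- s) \sum_(l <- s) F k l x)).
    apply: eq_Rintegral => x _; rewrite /p1 /p2 !big_distrlr/= -big_split/=.
    apply: eq_bigr => k _; rewrite -big_split/=; apply: eq_bigr => l _.
    by rewrite /F cosB sinB; ring.
  rewrite bounded_Rintegral_sum; last by move=> k; exact: bounded_measurable_sum.
  rewrite mulr_sumr big_seq [RHS]big_seq; apply: eq_bigr => k ks.
  rewrite bounded_Rintegral_sum// (bigD1_seq k)//= big1_seq ?addr0; last first.
    move=> l /andP[lk _]; rewrite /F bounded_RintegralD; last 2 first.
    - exact: bounded_measurableM.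
    - exact: bounded_measurableM.
    by rewrite !bounded_RintegralZ// intcos intsin eq_sym (negPf lk) !mulr0 addr0.
  rewrite /F bounded_RintegralD; last 2 first.
  - exact: bounded_measurableM.
  - exact: bounded_measurableM.
  by rewrite !bounded_RintegralZ// intcos intsin eqxx mulr1; ring.
have pos : 0 <= \int[mu]_(x in D) ((W * u1 x - p1 x) ^+ 2 + (W * u2 x - p2 x) ^+ 2).
  by apply: Rintegral_ge0 => x _; rewrite addr_ge0// sqr_ge0.
move: pos.
rewrite [X in 0 <= X -> _](_ : _ = \int[mu]_(x in D)
    (W ^+ 2 * (u1 x * u1 x + u2 x * u2 x) +
     ((- (2 * W)) * (u1 x * p1 x + u2 x * p2 x) + (p1 x * p1 x + p2 x * p2 x)))); last first.
  by apply: eq_Rintegral => x _; ring.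
have buu : bounded_measurable (fun x => u1 x * u1 x + u2 x * u2 x) by apply:
  bounded_measurableD; apply: bounded_measurableM.
have bup : bounded_measurable (fun x => u1 x * p1 x + u2 x * p2 x) by apply:
  bounded_measurableD; apply: bounded_measurableM.
have bpp : bounded_measurable (fun x => p1 x * p1 x + p2 x * p2 x) by apply:
  bounded_measurableD; apply: bounded_measurableM.
have bup' c : bounded_measurable (fun x => c * (u1 x * p1 x + u2 x * p2 x)) by apply:
  bounded_measurableM.
rewrite bounded_RintegralD; [|by apply: bounded_measurableM|exact: bounded_measurableD].
rewrite bounded_RintegralD// !bounded_RintegralZ// cross norm.
under [X in _ -> _ <= W * X]eq_Rintegral do rewrite !expr2.
set Q := \int[mu]_(_ in D) _; rewrite -/S => H.
rewrite -(ler_pM2l W0); move: H; rewrite expr2; lra.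
Qed.

End bessel.

End bounded_measurable.

Section trigonometric_integrals.
Context {R : realType}.
Local Notation leb := (@lebesgue_measure R).

Lemma is_derive_comp_scale (f df : R -> R) (c : R) :
  (forall x : R, is_derive x 1 f (df x)) ->
  forall x : R, is_derive x 1 (fun t => f (c * t)) (c * df (c * x)).
Proof.
move=> fdf x.
have h : is_derive x (1 : R) (fun t : R => c * t) c.
  by apply: is_derive_eq; rewrite /GRing.scale/= mulr1 ?addr0.
have := @is_derive1_comp R f (fun t => c * t) x (df (c * x)) c (fdf _) h.
by move=> H; apply: (is_derive_eq H); rewrite mulrC.
Qed.

Lemma integral_derivative (f df : R -> R) (a b : R) : a < b ->
  (forall x : R, is_derive x 1 f (df x)) -> continuous df ->
  \int[leb]_(x in `[a, b]) df x = f b - f a.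
Proof.
move=> ab fdf cdf.
have df1 x : derivable f x 1 by have := fdf x; case.
have cf : continuous f by move=> x; apply: differentiable_continuous; exact/derivable1_diffP.
rewrite /Rintegral (@continuous_FTC2 _ df f a b)//.
- exact: continuous_subspaceT.
- split.
  + by move=> x _.
  + exact/cvg_at_right_filter/cf.
  + exact/cvg_at_left_filter/cf.
- by move=> x _; rewrite derive1E; have := fdf x; move=> H; rewrite derive_val.
Qed.

Lemma sin_int_mul_pi (m : int) : sin (m%:~R * pi) = 0 :> R.
Proof.
have sn n : sin (n%:R * pi) = 0 :> R.
  elim: n => [|n IH]; first by rewrite mul0r sin0.
  by rewrite -natr1 mulrDl mul1r sinDpi IH oppr0.
case: m => n; first exact: sn.
by rewrite NegzE mulrNz mulNr sinN sn oppr0.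
Qed.

Lemma integral_cos_symmetric (c A : R) : 0 < A -> c != 0 ->
  \int[leb]_(x in `[- A, A]) cos (c * x) = 2 / c * sin (c * A).
Proof.
move=> A0 c0.
have D (x : R) : is_derive x 1 (fun t => c^-1 * sin (c * t)) (cos (c * x)).
  have h := is_derive_comp_scale c (@is_derive_sin R) x.
  have := @is_deriveZ _ _ _ (fun t => sin (c * t)) c^-1 x 1 _ h.
  by move=> H; apply: (is_derive_eq H); rewrite /GRing.scale/= mulrA mulVf// mul1r.
rewrite (integral_derivative _ D); last 2 first.
- by rewrite gtrN.
- move=> x; apply: continuous_comp; first exact: mulrl_continuous.
  exact: continuous_cos.
by rewrite mulrN sinN; field.
Qed.

Lemma integral_sin_symmetric (c A : R) : 0 < A ->
  \int[leb]_(x in `[- A, A]) sin (c * x) = 0.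
Proof.
move=> A0; have [->|c0] := eqVneq c 0.
  by under eq_Rintegral do rewrite mul0r sin0; rewrite Rintegral_cst ?mul0r.
have D (x : R) : is_derive x 1 (fun t => - c^-1 * cos (c * t)) (sin (c * x)).
  have h := is_derive_comp_scale c (@is_derive_cos R) x.
  have := @is_deriveZ _ _ _ (fun t => cos (c * t)) (- c^-1) x 1 _ h.
  by move=> H; apply: (is_derive_eq H);
    rewrite /GRing.scale/= mulrN mulrNN mulrA mulVf// mul1r.
rewrite (integral_derivative _ D); last 2 first.
- by rewrite gtrN.
- move=> x; apply: continuous_comp; first exact: mulrl_continuous.
  exact: continuous_sin.
by rewrite mulrN cosN subrr.
Qed.

Lemma lipschitz_of_derivative (f df : R -> R) :
  (forall x : R, is_derive x 1 f (df x)) -> (forall x, `|df x| <= 1) ->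
  forall x y, `|f x - f y| <= `|x - y|.
Proof.
move=> fdf df1 x y; wlog xy : x y / y <= x => [H|].
  have [/H//|/ltW /H] := leP y x.
  by rewrite distrC [leRHS]distrC.
have cf : continuous f.
  move=> z; apply: differentiable_continuous; apply/derivable1_diffP.
  by have := fdf z; case.
have [z _ ->] := @MVT_segment R f df y x xy (fun z _ => fdf z) (continuous_subspaceT cf).
by rewrite normrM ler_piMl.
Qed.

Lemma cos_lipschitz (x y : R) : `|cos x - cos y| <= `|x - y|.
Proof.
apply: (lipschitz_of_derivative (@is_derive_cos R)) => z.
by rewrite normrN sin_max.
Qed.

Lemma sin_lipschitz (x y : R) : `|sin x - sin y| <= `|x - y|.
Proof. by apply: (lipschitz_of_derivative (@is_derive_sin R)) => z; exact: cos_max. Qed.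

End trigonometric_integrals.

(** * Families indexed by the integers *)

Section countable_sums.
Context {R : realType} {I : countType}.

(** The indices that [pickle] does not reach carry the value 0, which alters no sum
    of squares. *)
Definition enumerated (F : I -> R) (n : nat) : R := oapp F 0 (pickle_inv n : option I).

Lemma enumerated_pickle (F : I -> R) (i : I) : enumerated F (pickle i) = F i.
Proof. by rewrite /enumerated pickleK_inv. Qed.

Lemma sum_enumerated_le (F : I -> R) (c : R) :
  (forall s : seq I, uniq s -> \sum_(i <- s) F i <= c) ->
  forall N, \sum_(n < N) enumerated F n <= c.
Proof.
move=> Fc N; have := Fc (pmap (@pickle_inv I) (iota 0 N)).
rewrite (pmap_uniq (@pickle_invK I)) ?iota_uniq// => /(_ isT).
congr (_ <= _); rewrite -(big_mkord xpredT) /index_iota subn0.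
elim: (iota 0 N) => [|n s IH]; first by rewrite !big_nil.
rewrite big_cons /= /enumerated -/enumerated -IH.
by case: (pickle_inv n) => [i|]/=; rewrite ?big_cons ?add0r.
Qed.

Lemma ler_sum_uniq_subset (F : I -> R) (s s' : seq I) : uniq s -> uniq s' ->
  {subset s <= s'} -> (forall i, 0 <= F i) ->
  \sum_(i <- s) F i <= \sum_(i <- s') F i.
Proof.
move=> us us' ss' F0.
have /(perm_big _)-> : perm_eq s [seq i <- s' | i \in s].
  apply: uniq_perm => //; first exact: filter_uniq.
  move=> i; rewrite mem_filter; case: (boolP (i \in s)) => //= /ss' ->//.
by rewrite big_filter big_mkcond; apply: ler_sum => i _; case: ifP.
Qed.

End countable_sums.

Section periodized_square_integral.
Context {R : realType}.
Local Notation leb := (@lebesgue_measure R).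

(** Cutting the line into the cells of the lattice of the shifts turns the
    integral of the square of one member into an integral over a single cell of
    the sum of the squares of all members. *)
Lemma integral_sqr_shifted_family (F : int -> R -> R) (w b : R) : 0 < w ->
  (forall k, measurable_fun setT (F k)) ->
  (forall k l y, F k (y + l%:~R * w) = F (k - l) y) ->
  (forall s y, uniq s -> \sum_(k <- s) F k y ^+ 2 <= b ^+ 2) ->
  forall k, (\int[leb]_y (F k y ^+ 2)%:E <= (w * b ^+ 2)%:E)%E.
Proof.
move=> w0 mF shiftF sumF k.
(* The cell of the lattice that has the number [n] in the enumeration of [int]. *)
pose cell n : set R := if pickle_inv n is Some l
  then `[l%:~R * w, (l + 1)%:~R * w[%classic else set0.
have mcell n : measurable (cell n).
  by rewrite /cell; case: pickle_inv => [l|]; [exact: measurable_itv|exact: measurable0].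
have mF2 l : measurable_fun setT (fun y => (F l y ^+ 2)%:E).
  by apply/measurable_EFinP; exact: measurable_funX.
have cellT : \bigcup_n cell n = [set: R].
  apply/seteqP; split=> // y _; exists (pickle (Num.floor (y / w))) => //.
  rewrite /cell pickleK_inv /= in_itv/= -ler_pdivlMr// -ltr_pdivrMr//.
  by rewrite floor_le_tmp floorD1_gt.
have trivcell : trivIset setT cell.
  move=> m n _ _ [y []]; rewrite /cell.
  case Em : (pickle_inv m) => [l|//]; case En : (pickle_inv n) => [l'|//] /=.
  rewrite !in_itv/= -!ler_pdivlMr// -!ltr_pdivrMr// => /floor_def h1 /floor_def h2.
  have E : l = l' by rewrite -h1 -h2.
  have := @pickle_invK int m; have := @pickle_invK int n.
  by rewrite Em En /= E => -> ->.
rewrite -cellT ge0_integral_bigcup//; last 2 first.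
- by rewrite cellT; exact: mF2.
- by move=> y _; rewrite lee_fin sqr_ge0.
pose G n y := enumerated (fun l => F (k - l) y ^+ 2) n.
have G0 n y : 0 <= G n y.
  by rewrite /G /enumerated; case: pickle_inv => //= l; exact: sqr_ge0.
have mG n : measurable_fun setT (fun y => (G n y)%:E).
  rewrite /G /enumerated; case: pickle_inv => [l|]/=; first exact: mF2.
  exact: measurable_cst.
have -> : (\sum_(n <oo) \int[leb]_(y in cell n) (F k y ^+ 2)%:E =
    \sum_(n <oo) \int[leb]_(y in `[0%R, w[) (G n y)%:E)%E.
  apply: eq_eseriesr => n _; rewrite /cell /G /enumerated.
  case: pickle_inv => [l|]/=; last by rewrite integral_set0 integral0.
  rewrite integral_mkcond [RHS]integral_mkcond.
  rewrite -(@ge0_integral_translation _ (l%:~R * w)); last 2 first.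
  - by apply/(measurable_restrictT _ _).1 => //; exact: measurable_funTS.
  - by move=> y; apply: erestrict_ge0 => z _; rewrite lee_fin sqr_ge0.
  apply: eq_integral => y _; rewrite !patchE shiftF !mem_setE !in_itv/=.
  by rewrite lerDr intrD mulrDl mul1r (addrC y) ltrD2l.
rewrite -integral_nneseries//; last 2 first.
- by move=> n; apply: measurable_funTS; exact: mG.
- by move=> n y _; rewrite lee_fin.
apply: (@le_trans _ _ (\int[leb]_(y in `[0%R, w[) (b ^+ 2)%:E)%E).
  apply: ge0_le_integral => //.
  - by move=> y _; apply: nneseries_ge0 => n _ _; rewrite lee_fin.
  - apply: (@ge0_emeasurable_sum _ _ _ _ (fun n y => (G n y)%:E) xpredT) => //.
    + by move=> n y _ _; rewrite lee_fin.
    + by move=> n _; apply: measurable_funTS; exact: mG.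
  - move=> y _; apply: lime_le.
      by apply: is_cvg_nneseries => n _ _; rewrite lee_fin.
    near=> N; rewrite big_mkord sumEFin lee_fin /G.
    apply: sum_enumerated_le => s us.
    rewrite -(big_map (fun l => k - l) xpredT (fun l => F l y ^+ 2)).
    by apply: sumF; rewrite map_inj_uniq// => x z /(addrI k)/oppr_inj.
rewrite integral_cst//= lebesgue_measure_itv/= lte_fin w0 sube0 -EFinM.
by rewrite mulrC.
Unshelve. all: by end_near. Qed.

End periodized_square_integral.

(** * Oscillatory integrals over a band *)

Lemma lipschitz_measurable {R : realType} (f : R -> R) (L : R) :
  (forall x y, `|f x - f y| <= L * `|x - y|) -> measurable_fun setT f.
Proof.
move=> fL; apply: continuous_measurable_fun => x.
apply/cvgrPdist_lt => e e0; near=> y.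
rewrite (le_lt_trans (fL x y))//.
have L1 : 0 < `|L| + 1 by rewrite ltr_wpDl.
apply: (@le_lt_trans _ _ ((`|L| + 1) * `|x - y|)).
  by rewrite ler_wpM2r// (le_trans (ler_norm _))// lerDl.
rewrite mulrC -ltr_pdivlMr//; near: y.
by apply: cvgr_dist_lt => //; rewrite divr_gt0.
Unshelve. all: by end_near. Qed.

Section oscillatory_integrals.
Context {R : realType}.
Local Notation leb := (@lebesgue_measure R).
Variables (h1 h2 : R -> R) (K w : R) (N : nat).
Hypotheses (mh1 : measurable_fun setT h1) (mh2 : measurable_fun setT h2).
Hypothesis hK : forall t, h1 t ^+ 2 + h2 t ^+ 2 <= K ^+ 2.
Hypotheses (K0 : 0 <= K) (w0 : 0 < w) (N0 : (0 < N)%N).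

(** The phases [exp (i k w t)] have the common period [2 pi / w], and the interval
    of this half-length holds exactly [N] of these periods.  Hence they are
    orthogonal on it, and [N] can be taken so large that the interval contains a
    given band. *)
Definition half_period : R := N%:R * pi / w.
Local Notation A := half_period.

(** [osc_re k] and [osc_im k] are the real and imaginary parts of the inverse
    Fourier transform of [h1 + i h2], up to the factor [2 pi], at [y - k w]. *)
Definition osc_re (k : int) (y : R) : R := \int[leb]_(t in `[- A, A])
  (h1 t * cos (t * (y - k%:~R * w)) - h2 t * sin (t * (y - k%:~R * w))).

Definition osc_im (k : int) (y : R) : R := \int[leb]_(t in `[- A, A])
  (h1 t * sin (t * (y - k%:~R * w)) + h2 t * cos (t * (y - k%:~R * w))).

Lemma half_period_gt0 : 0 < A.
Proof. by rewrite divr_gt0// mulr_gt0 ?pi_gt0// ltr0n. Qed.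
Let A0 := half_period_gt0.

Let lebA : leb `[- A, A] = (2 * A)%:E.
Proof.
rewrite lebesgue_measure_itv/= lte_fin gtrN// -EFinD.
by congr (_%:E); ring.
Qed.

Let lebA_lty : (leb `[(- A)%R, A] < +oo)%E.
Proof. by rewrite lebA ltry. Qed.

Let fine_lebA : fine (leb `[- A, A]) = 2 * A.
Proof. by rewrite lebA. Qed.

Let h1K t : `|h1 t| <= K.
Proof.
rewrite -(ler_pXn2r (n := 2))// ?nnegrE// real_normK ?num_real//.
by apply: le_trans (hK t); rewrite lerDl sqr_ge0.
Qed.

Let h2K t : `|h2 t| <= K.
Proof.
rewrite -(ler_pXn2r (n := 2))// ?nnegrE// real_normK ?num_real//.
by apply: le_trans (hK t); rewrite lerDr sqr_ge0.
Qed.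

Let b1 : bounded_measurable h1. Proof. by split => //; exists K. Qed.
Let b2 : bounded_measurable h2. Proof. by split => //; exists K. Qed.

Let mphase z : measurable_fun setT (fun t : R => t * z).
Proof. exact: mulrr_measurable. Qed.

Let bcos z := bounded_measurable_cos (mphase z).
Let bsin z := bounded_measurable_sin (mphase z).

(** Moving [y] multiplies all the phases by a common factor of modulus one, which
    preserves their orthogonality: so Bessel's inequality gives a bound that is
    uniform in [y]. *)
Lemma sum_sqr_osc (s : seq int) (y : R) : uniq s ->
  \sum_(k <- s) (osc_re k y ^+ 2 + osc_im k y ^+ 2) <= (2 * A * K) ^+ 2.
Proof.
move=> us; have A2 : 0 < 2 * A by rewrite mulr_gt0.
have phaseB (k l : int) (t : R) : t * (y - k%:~R * w) - t * (y - l%:~R * w) =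
    (l - k)%:~R * w * t by rewrite intrB; ring.
have := @bessel_inequality R _ _ leb `[- A, A] (measurable_itv _) lebA_lty h1 h2
  (fun k t => t * (y - k%:~R * w)) (2 * A) b1 b2 (fun k => mphase _).
move=> /(_ _ _ s us A2) H; apply: le_trans (H _ _) _.
- move=> k l; under eq_Rintegral do rewrite phaseB.
  have [->|kl] := eqVneq k l.
    under eq_Rintegral do rewrite subrr !mul0r cos0.
    by rewrite Rintegral_cst// fine_lebA mul1r mulr1.
  rewrite integral_cos_symmetric//; last first.
    by apply: mulf_neq0; [rewrite intr_eq0 subr_eq0 eq_sym|rewrite gt_eqF].
  rewrite (_ : _ * A = ((l - k) * N%:Z)%:~R * pi); last first.
    by rewrite intrM /half_period; field; rewrite gt_eqF.
  by rewrite sin_int_mul_pi !mulr0.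
- by move=> k l; under eq_Rintegral do rewrite phaseB; rewrite integral_sin_symmetric.
- rewrite (_ : _ ^+ 2 = 2 * A * (K ^+ 2 * (2 * A))); last by ring.
  rewrite ler_pM2l// -[X in _ * X]fine_lebA (le_trans (ler_norm _))//.
  apply: normr_bounded_Rintegral => //.
    by apply: bounded_measurableD; apply: bounded_measurableM.
  by move=> t _; rewrite ger0_norm ?addr_ge0 ?sqr_ge0.
Qed.

Lemma osc_re_shift k l y : osc_re k (y + l%:~R * w) = osc_re (k - l) y.
Proof.
rewrite /osc_re; have -> // : y + l%:~R * w - k%:~R * w = y - (k - l)%:~R * w.
by rewrite intrB; ring.
Qed.

Lemma osc_im_shift k l y : osc_im k (y + l%:~R * w) = osc_im (k - l) y.
Proof.
rewrite /osc_im; have -> // : y + l%:~R * w - k%:~R * w = y - (k - l)%:~R * w.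
by rewrite intrB; ring.
Qed.

Definition osc_lipschitz_constant : R := 2 * K * A * (2 * A).
Local Notation L := osc_lipschitz_constant.

Let phase_lipschitz (f : R -> R) (k : int) (t y y' : R) :
  (forall x z, `|f x - f z| <= `|x - z|) -> `[- A, A]%classic t ->
  `|f (t * (y - k%:~R * w)) - f (t * (y' - k%:~R * w))| <= A * `|y - y'|.
Proof.
move=> fL; rewrite /= in_itv/= => tA; rewrite (le_trans (fL _ _))//.
rewrite (_ : _ - _ = t * (y - y')); last by ring.
by rewrite normrM ler_wpM2r// ler_norml.
Qed.

Lemma osc_re_lipschitz k y y' : `|osc_re k y - osc_re k y'| <= L * `|y - y'|.
Proof.
have bX z : bounded_measurable (fun t => h1 t * cos (t * z) - h2 t * sin (t * z)).
  by apply: bounded_measurableB; apply: bounded_measurableM.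
have := bounded_RintegralB (mu := leb) (measurable_itv `[- A, A]) lebA_lty
  (bX (y - k%:~R * w)) (bX (y' - k%:~R * w)).
move=> /esym; rewrite /osc_re /osc_im => ->.
rewrite (_ : L * _ = 2 * K * A * `|y - y'| * (2 * A)); last by rewrite /L; ring.
rewrite -fine_lebA; apply: normr_bounded_Rintegral => //.
  exact: (bounded_measurableB (bX _) (bX _)).
move=> t tA.
have c := phase_lipschitz k y y' (@cos_lipschitz R) tA.
have s := phase_lipschitz k y y' (@sin_lipschitz R) tA.
rewrite [X in `|X|](_ : _ = h1 t * (cos (t * (y - k%:~R * w)) - cos (t * (y' - k%:~R * w)))
  - h2 t * (sin (t * (y - k%:~R * w)) - sin (t * (y' - k%:~R * w)))); last by ring.
rewrite (le_trans (ler_normB _ _))// !normrM.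
rewrite (_ : 2 * _ * _ * _ = K * (A * `|y - y'|) + K * (A * `|y - y'|)); last by ring.
by rewrite lerD// ler_pM.
Qed.

Lemma osc_im_lipschitz k y y' : `|osc_im k y - osc_im k y'| <= L * `|y - y'|.
Proof.
have bX z : bounded_measurable (fun t => h1 t * sin (t * z) + h2 t * cos (t * z)).
  by apply: bounded_measurableD; apply: bounded_measurableM.
have := bounded_RintegralB (mu := leb) (measurable_itv `[- A, A]) lebA_lty
  (bX (y - k%:~R * w)) (bX (y' - k%:~R * w)).
move=> /esym; rewrite /osc_re /osc_im => ->.
rewrite (_ : L * _ = 2 * K * A * `|y - y'| * (2 * A)); last by rewrite /L; ring.
rewrite -fine_lebA; apply: normr_bounded_Rintegral => //.
  exact: (bounded_measurableB (bX _) (bX _)).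
move=> t tA.
have c := phase_lipschitz k y y' (@cos_lipschitz R) tA.
have s := phase_lipschitz k y y' (@sin_lipschitz R) tA.
rewrite [X in `|X|](_ : _ = h1 t * (sin (t * (y - k%:~R * w)) - sin (t * (y' - k%:~R * w)))
  + h2 t * (cos (t * (y - k%:~R * w)) - cos (t * (y' - k%:~R * w)))); last by ring.
rewrite (le_trans (ler_normD _ _))// !normrM.
rewrite (_ : 2 * _ * _ * _ = K * (A * `|y - y'|) + K * (A * `|y - y'|)); last by ring.
by rewrite lerD// ler_pM.
Qed.

End oscillatory_integrals.

(** * Complex numbers by components *)

Section complex_components.
Local Open Scope complex_scope.
Context {R : realType}.
Implicit Types z w : R[i].

Lemma ReMc z w : complex.Re (z * w) =
  complex.Re z * complex.Re w - complex.Im z * complex.Im w.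
Proof. by case: z; case: w. Qed.

Lemma ImMc z w : complex.Im (z * w) =
  complex.Re z * complex.Im w + complex.Im z * complex.Re w.
Proof. by case: z; case: w. Qed.

Lemma cabsE z : cabs z = Num.sqrt (complex.Re z ^+ 2 + complex.Im z ^+ 2).
Proof. by case: z. Qed.

Lemma cabs_le z : cabs z <= `|complex.Re z| + `|complex.Im z|.
Proof.
rewrite cabsE -[leRHS]ger0_norm ?addr_ge0// -sqrtr_sqr ler_sqrt ?sqr_ge0//.
rewrite -(real_normK (num_real (complex.Re z))) -(real_normK (num_real (complex.Im z))).
by rewrite sqrrD lerD2r lerDl mulrn_wge0// mulr_ge0.
Qed.

(** This form is valid for [w = 0] as well, because then both sides are 0. *)
Lemma div_mul_conjc (c : R) z w : 0 < c ->
  let n := complex.Re w ^+ 2 + complex.Im w ^+ 2 in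
  z / (c%:C * conjc w) =
  ((complex.Re z * complex.Re w - complex.Im z * complex.Im w) / (c * n)) +i*
  ((complex.Re z * complex.Im w + complex.Im z * complex.Re w) / (c * n)).
Proof.
case: z => z1 z2; case: w => w1 w2 c0 /=.
have [n0|n0] := eqVneq (w1 ^+ 2 + w2 ^+ 2) 0.
  have [-> ->] : w1 = 0 /\ w2 = 0.
    by move/eqP: n0; rewrite paddr_eq0 ?sqr_ge0// !sqrf_eq0 => /andP[/eqP-> /eqP->].
  rewrite /conjc oppr0 (_ : 0 +i* 0 = 0)// mulr0 invr0 mulr0 !mulr0 subrr addr0 !mul0r.
  by [].
have mulcE (a b c' d' : R) : (a +i* b) * (c' +i* d') =
  (a * c' - b * d') +i* (a * d' + b * c') by [].
have invcE (a b : R) : (a +i* b)^-1 =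
  (a / (a ^+ 2 + b ^+ 2)) -i* (b / (a ^+ 2 + b ^+ 2)) by [].
have -> : c%:C * conjc (w1 +i* w2) = (c * w1) +i* (- (c * w2)).
  by rewrite [LHS]mulcE !mul0r subr0 addr0 mulrN.
have nz : (c * w1) ^+ 2 + (- (c * w2)) ^+ 2 != 0.
  have -> : (c * w1) ^+ 2 + (- (c * w2)) ^+ 2 = c ^+ 2 * (w1 ^+ 2 + w2 ^+ 2) by ring.
  by rewrite mulf_neq0// expf_neq0// gt_eqF.
by rewrite invcE [LHS]mulcE; congr (_ +i* _); field; rewrite n0 nz gt_eqF.
Qed.

Lemma cisD (x y : R) : cis (x + y) = cis x * cis y.
Proof. by rewrite /cis cosD sinD (addrC (sin x * cos y)). Qed.

End complex_components.

(** * Fourier transforms of integrable functions and of probability measures *)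

Section phase_integrals.
Local Open Scope complex_scope.
Context {R : realType} {d : measure_display} {T : measurableType d}.
Variables (mu : {measure set T -> \bar R}) (rho X : T -> R) (f : R -> R).
Hypotheses (irho : mu.-integrable setT (EFin \o rho)) (mX : measurable_fun setT X).
Hypotheses (cf : continuous f) (f1 : forall x, `|f x| <= 1).

Let mrho : measurable_fun setT rho.
Proof. by apply/measurable_EFinP; exact: measurable_int irho. Qed.

Let mphase t : measurable_fun setT (fun x => rho x * f (- (t * X x))).
Proof.
apply: measurable_funM => //; apply: measurableT_comp.
  exact: continuous_measurable_fun.
by apply: measurable_funN; exact: measurable_funM.
Qed.

Let phase_le t x : `|rho x * f (- (t * X x))| <= `|rho x|.
Proof. by rewrite normrM ler_piMr. Qed.

Lemma phase_integrable t : mu.-integrable setT (EFin \o (fun x => rho x * f (- (t * X x)))).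
Proof.
apply: le_integrable irho => //; first exact/measurable_EFinP.
by move=> x _ /=; rewrite lee_fin.
Qed.

Lemma normr_phase_integral t :
  `|\int[mu]_x (rho x * f (- (t * X x)))| <= \int[mu]_x `|rho x|.
Proof.
rewrite (le_trans (le_normr_Rintegral _ (phase_integrable t)))//.
apply: le_Rintegral => //.
- exact: integrable_norm (phase_integrable t).
- exact: integrable_norm.
Qed.

Lemma continuous_phase_integral :
  continuous (fun t : R => \int[mu]_x (rho x * f (- (t * X x)))).
Proof.
move=> t0.
have := @continuity_under_integral R d T mu (fun t x => rho x * f (- (t * X x)))
  setT measurableT (t0 - 1) (t0 + 1) _ _ (fun x => `|rho x|) _ _.
apply => //.
- by move=> t _; exact: phase_integrable.
- apply: aeW => x _ t _; apply: cvgM; first exact: cvg_cst.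
  apply: continuous_comp; last exact: cf.
  by apply: cvgN; apply: cvgM; [exact: cvg_id|exact: cvg_cst].
- exact: integrable_norm.
- by move=> t _; apply: aeW => x _.
- by rewrite inE/= in_itv/= gtrBl ltrDl ltr01.
Qed.

End phase_integrals.

Lemma Rintegral_linear {R : realType} {d : measure_display} {T : measurableType d}
    (mu : {measure set T -> \bar R}) (f g : T -> R) (a b : R) :
  mu.-integrable setT (EFin \o f) -> mu.-integrable setT (EFin \o g) ->
  \int[mu]_x (a * f x + b * g x) = a * \int[mu]_x f x + b * \int[mu]_x g x.
Proof.
move=> intf intg; rewrite RintegralD// ?RintegralZl//.
- by have := integrableZl measurableT a intf; apply: eq_integrable.
- by have := integrableZl measurableT b intg; apply: eq_integrable.
Qed.

Section fourier_transform.
Local Open Scope complex_scope.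
Context {R : realType}.
Local Notation leb := (@lebesgue_measure R).
Variable phi : R -> R.
Hypothesis iphi : leb.-integrable setT (EFin \o phi).

Lemma fourierE (h : R -> R) t : fourier (fun x => (h x)%:C) t =
  (\int[leb]_x (h x * cos (- (t * x)))) +i* (\int[leb]_x (h x * sin (- (t * x)))).
Proof.
rewrite /fourier /cintegral; congr (_ +i* _); apply: eq_Rintegral => x _.
  by rewrite ReMc /= mul0r subr0.
by rewrite ImMc /= mul0r addr0.
Qed.

Let mphi : measurable_fun setT phi.
Proof. by apply/measurable_EFinP; exact: measurable_int iphi. Qed.

Lemma Rintegral_translation c (h : R -> R) : measurable_fun setT h ->
  \int[leb]_x h (x + c) = \int[leb]_x h x.
Proof.
move=> mh; rewrite /Rintegral; congr fine.
by apply: (@integral_translation _ c (EFin \o h)); exact/measurable_EFinP.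
Qed.

Lemma fourier_translate k t : fourier (fun x => (translate phi k x)%:C) t =
  fourier (fun x => (phi x)%:C) t * cis (- (t * k%:~R)).
Proof.
have mid : measurable_fun [set: measurableTypeR R] (fun x => x : R) by exact: measurable_id.
have ic := phase_integrable iphi mid (@continuous_cos R) (@cos_max R) t.
have isn := phase_integrable iphi mid (@continuous_sin R) (@sin_max R) t.
have mtr : measurable_fun setT (translate phi k).
  by apply: measurableT_comp => //; exact: measurable_funB.
have mt : measurable_fun setT (fun x : R => - (t * x)).
  by apply: measurable_funN; exact: measurable_funM.
rewrite !fourierE /cis; set c := cos (- (t * k%:~R)); set s := sin (- (t * k%:~R)).
have shiftE (x : R) : - (t * (x + k%:~R)) = - (t * x) + - (t * k%:~R) by ring.
have trE (x : R) : translate phi k (x + k%:~R) = phi x by rewrite /translate addrK.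
rewrite -(@Rintegral_translation k%:~R (fun x => translate phi k x * cos (- (t * x))));
  last first.
  by apply: measurable_funM => //; exact: (bounded_measurable_cos mt).1.
rewrite -(@Rintegral_translation k%:~R (fun x => translate phi k x * sin (- (t * x))));
  last first.
  by apply: measurable_funM => //; exact: (bounded_measurable_sin mt).1.
congr (_ +i* _).
  rewrite [RHS](_ : _ = c * (\int[leb]_x (phi x * cos (- (t * x)))) +
    - s * (\int[leb]_x (phi x * sin (- (t * x))))); last by ring.
  rewrite -(Rintegral_linear c (- s) ic isn); apply: eq_Rintegral => x _.
  by rewrite trE shiftE cosD -/c -/s; ring.
rewrite [RHS](_ : _ = s * (\int[leb]_x (phi x * cos (- (t * x)))) +
  c * (\int[leb]_x (phi x * sin (- (t * x))))); last by ring.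
rewrite -(Rintegral_linear s c ic isn); apply: eq_Rintegral => x _.
by rewrite trE shiftE sinD -/c -/s; ring.
Qed.

Lemma Re_fourier_le t : `|complex.Re (fourier (fun x => (phi x)%:C) t)| <=
  \int[leb]_x `|phi x|.
Proof. by rewrite fourierE; apply: normr_phase_integral => //;
  [exact: continuous_cos|exact: cos_max]. Qed.

Lemma Im_fourier_le t : `|complex.Im (fourier (fun x => (phi x)%:C) t)| <=
  \int[leb]_x `|phi x|.
Proof. by rewrite fourierE; apply: normr_phase_integral => //;
  [exact: continuous_sin|exact: sin_max]. Qed.

Lemma measurable_Re_fourier :
  measurable_fun setT (fun t => complex.Re (fourier (fun x => (phi x)%:C) t)).
Proof.
apply: continuous_measurable_fun; under eq_fun do rewrite fourierE.
apply: continuous_phase_integral => //; [exact: continuous_cos|exact: cos_max].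
Qed.

Lemma measurable_Im_fourier :
  measurable_fun setT (fun t => complex.Im (fourier (fun x => (phi x)%:C) t)).
Proof.
apply: continuous_measurable_fun; under eq_fun do rewrite fourierE.
apply: continuous_phase_integral => //; [exact: continuous_sin|exact: sin_max].
Qed.

End fourier_transform.

Section fourier_of_probability.
Local Open Scope complex_scope.
Context {R : realType}.
Variable err : probability R R.

Let icst : err.-integrable setT (EFin \o (fun _ : R => 1)).
Proof.
apply: (@bounded_integrable _ _ _ _ _ 1); first exact: measurable_cst.
by move=> w; rewrite normr1.
Qed.

Lemma fourier_measureE t : fourier_measure err t =
  (\int[err]_x (1 * cos (- (t * x)))) +i* (\int[err]_x (1 * sin (- (t * x)))).
Proof. by rewrite /fourier_measure /cintegral; congr (_ +i* _);
  apply: eq_Rintegral => x _; rewrite mul1r. Qed.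

Lemma continuous_Re_fourier_measure : continuous (fun t => complex.Re (fourier_measure err t)).
Proof.
under eq_fun do rewrite fourier_measureE.
by apply: continuous_phase_integral => //; [exact: continuous_cos|exact: cos_max].
Qed.

Lemma continuous_Im_fourier_measure : continuous (fun t => complex.Im (fourier_measure err t)).
Proof.
under eq_fun do rewrite fourier_measureE.
by apply: continuous_phase_integral => //; [exact: continuous_sin|exact: sin_max].
Qed.

Lemma continuous_cabs_fourier_measure : continuous (fun t => cabs (fourier_measure err t)).
Proof.
under eq_fun do rewrite cabsE.
move=> t; apply: (@continuous_comp _ _ _ (fun t => complex.Re (fourier_measure err t) ^+ 2 +
  complex.Im (fourier_measure err t) ^+ 2) Num.sqrt); last exact: sqrt_continuous.
by apply: cvgD; apply: cvgM;
  [exact: continuous_Re_fourier_measure|exact: continuous_Re_fourier_measure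
  |exact: continuous_Im_fourier_measure|exact: continuous_Im_fourier_measure].
Qed.

Variables (j a : R).
Hypothesis a0 : 0 <= a.
Hypothesis pos : forall t, t \in `[- (2 `^ j * a), 2 `^ j * a] ->
  0 < cabs (fourier_measure err t).

Lemma delta_le t : t \in `[- (2 `^ j * a), 2 `^ j * a] ->
  delta err j a <= cabs (fourier_measure err t).
Proof.
move=> ta; apply: ge_inf; last by exists t.
by exists 0 => _ [s sa <-]; exact/ltW/pos.
Qed.

(** The infimum is attained, as it is taken over a compact interval. *)
Lemma delta_gt0 : 0 < delta err j a.
Proof.
have ja : - (2 `^ j * a) <= 2 `^ j * a.
  by rewrite ge0_cp// mulr_ge0 ?powR_ge0.
have [t ta tmin] := @EVT_min R (fun t => cabs (fourier_measure err t)) _ _ ja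
  (continuous_subspaceT continuous_cabs_fourier_measure).
apply: (@lt_le_trans _ _ (cabs (fourier_measure err t))); first exact: pos.
apply: lb_le_inf; first by exists (cabs (fourier_measure err t)), t.
by move=> _ [s sa <-]; exact: tmin.
Qed.

End fourier_of_probability.

(** * The deconvolved scaling function *)

Section deconvolved_scaling_function.
Local Open Scope complex_scope.
Context {R : realType}.
Local Notation leb := (@lebesgue_measure R).
Variables (phi : R -> R) (err : probability R R) (j a a0 : R) (N : nat).
Hypothesis iphi : leb.-integrable setT (EFin \o phi).
Local Notation F := (fourier (fun x => (phi x)%:C)).
Hypothesis supp : forall t, t \notin `[- a, a] -> F t = 0.
Hypothesis supp0 : forall t, t \notin `[- a0, a0] -> F t = 0.
Hypotheses (a_ge0 : 0 <= a) (N0 : (0 < N)%N) (a0N : a0 <= N%:R * pi).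
Hypothesis err_pos : forall t, t \in `[- (2 `^ j * a), 2 `^ j * a] ->
  0 < cabs (fourier_measure err t).

Let w : R := 2 `^ (- j).
Let l : R := \int[leb]_x `|phi x|.
Let del : R := delta err j a.

Let w0 : 0 < w. Proof. exact: powR_gt0. Qed.
Let l0 : 0 <= l. Proof. by apply: Rintegral_ge0. Qed.
Let del0 : 0 < del. Proof. exact: delta_gt0. Qed.
Let twoj : 2 `^ j = w^-1. Proof. by rewrite /w powRN invrK. Qed.

Let h t := F (w * t) / ((2 `^ j)%:C * conjc (fourier_measure err t)).
Let h1 t := complex.Re (h t).
Let h2 t := complex.Im (h t).
Let K := 2 * l * w / del.

Let z1 t := complex.Re (F (w * t)).
Let z2 t := complex.Im (F (w * t)).
Let g1 t := complex.Re (fourier_measure err t).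
Let g2 t := complex.Im (fourier_measure err t).
Let q t := w * (g1 t ^+ 2 + g2 t ^+ 2)^-1.

Let hE t : h t = ((z1 t * g1 t - z2 t * g2 t) * q t) +i* ((z1 t * g2 t + z2 t * g1 t) * q t).
Proof. by rewrite /h div_mul_conjc ?powR_gt0// twoj invfM invrK. Qed.

Let h1E t : h1 t = (z1 t * g1 t - z2 t * g2 t) * q t.
Proof. by rewrite /h1 hE. Qed.

Let h2E t : h2 t = (z1 t * g2 t + z2 t * g1 t) * q t.
Proof. by rewrite /h2 hE. Qed.

Let mh : measurable_fun setT h1 /\ measurable_fun setT h2.
Proof.
have mw : measurable_fun setT (fun t : R => w * t) by exact: mulrl_measurable.
have m1 : measurable_fun setT z1.
  exact: (measurableT_comp (measurable_Re_fourier iphi) mw).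
have m2 : measurable_fun setT z2.
  exact: (measurableT_comp (measurable_Im_fourier iphi) mw).
have n1 : measurable_fun setT g1.
  exact: continuous_measurable_fun (@continuous_Re_fourier_measure R err).
have n2 : measurable_fun setT g2.
  exact: continuous_measurable_fun (@continuous_Im_fourier_measure R err).
have mq : measurable_fun setT q.
  apply: measurable_funM => //.
  rewrite (_ : (fun t => _) = (@powR R ^~ (-1)) \o (fun t => g1 t ^+ 2 + g2 t ^+ 2)).
    apply: measurableT_comp; first exact: measurable_powR.
    by apply: measurable_funD; exact: measurable_funX.
  by apply/funext => t /=; rewrite powR_inv1// addr_ge0 ?sqr_ge0.
rewrite (funext h1E) (funext h2E); split; apply: measurable_funM => //.
  by apply: measurable_funB; apply: measurable_funM.
by apply: measurable_funD; apply: measurable_funM.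
Qed.

Let h_supp t : F (w * t) = 0 -> h t = 0.
Proof. by rewrite /h => ->; rewrite mul0r. Qed.

Let hK t : h1 t ^+ 2 + h2 t ^+ 2 <= K ^+ 2.
Proof.
have [ta|ta] := boolP (w * t \in `[- a, a]); last first.
  by rewrite /h1 /h2 (h_supp (supp ta)) expr0n addr0 sqr_ge0.
have ta' : t \in `[- (2 `^ j * a), 2 `^ j * a].
  by move: ta; rewrite !in_itv/= twoj -mulrN ler_pdivrMl// ler_pdivlMl.
have dn := delta_le err_pos ta'; rewrite -/del cabsE -/(g1 t) -/(g2 t) in dn.
have z1l := Re_fourier_le iphi (w * t); rewrite -/l -/(z1 t) in z1l.
have z2l := Im_fourier_le iphi (w * t); rewrite -/l -/(z2 t) in z2l.
rewrite h1E h2E /q; set n := g1 t ^+ 2 + g2 t ^+ 2.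
rewrite -/n in dn.
have nd : del ^+ 2 <= n.
  rewrite -(@sqr_sqrtr _ n) ?addr_ge0 ?sqr_ge0//.
  by rewrite lerXn2r ?nnegrE ?sqrtr_ge0// ltW.
have n0 : 0 < n by rewrite (lt_le_trans _ nd)// exprn_gt0.
have -> : ((z1 t * g1 t - z2 t * g2 t) * (w / n)) ^+ 2 +
    ((z1 t * g2 t + z2 t * g1 t) * (w / n)) ^+ 2 =
    (z1 t ^+ 2 + z2 t ^+ 2) * w ^+ 2 / n by rewrite /n; field; rewrite -/n gt_eqF.
have -> : K ^+ 2 = (4 * l ^+ 2) * w ^+ 2 / del ^+ 2 by rewrite /K; field; rewrite gt_eqF.
have zl : z1 t ^+ 2 + z2 t ^+ 2 <= 4 * l ^+ 2.
  have s z : `|z| <= l -> z ^+ 2 <= l ^+ 2.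
    by move=> zl; rewrite -(real_normK (num_real z)) lerXn2r ?nnegrE// (le_trans _ zl).
  have := s _ z1l; have := s _ z2l; have := sqr_ge0 l; lra.
apply: ler_pM.
- by rewrite mulr_ge0 ?addr_ge0 ?sqr_ge0.
- by rewrite invr_ge0 ltW.
- by rewrite ler_wpM2r ?sqr_ge0.
- by rewrite lef_pV2 ?posrE// exprn_gt0.
Qed.

Let K0 : 0 <= K.
Proof. by rewrite /K !mulr_ge0 ?invr_ge0// ltW. Qed.

Local Notation ore := (osc_re h1 h2 w N).
Local Notation oim := (osc_im h1 h2 w N).

(** Translating [phi] multiplies its Fourier transform by a phase, so all the
    functions [phi_tilde k] are oscillatory integrals of one and the same function,
    the quotient of the transforms of [phi] and of the error law. *)
Lemma phi_tildeE k y : phi_tilde phi err j k y =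
  ((2 * pi)^-1 * ore k y) +i* ((2 * pi)^-1 * oim k y).
Proof.
pose th t := t * (y - k%:~R * w).
have E t : fourier (fun x => (translate phi k x)%:C) (2 `^ (- j) * t) /
    ((2 `^ j)%:C * conjc (fourier_measure err t)) * cis (t * y) = h t * cis (th t).
  rewrite fourier_translate// -/w [X in X * cis (t * y)]mulrAC -[LHS]mulrA -cisD.
  by congr (_ * cis _); rewrite /th; ring.
have off t : t \notin `[- half_period w N, half_period w N] -> h t = 0.
  move=> tA; apply/h_supp/supp0; apply: contra tA.
  rewrite !in_itv/= => /andP[t1 t2].
  rewrite /half_period lerNl !ler_pdivlMr// mulNr lerNl ![_ * w]mulrC.
  by rewrite (le_trans _ t1) ?lerN2 ?(le_trans t2 a0N).
have restr (f : R -> R) : (forall t, h t = 0 -> f t = 0) ->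
    \int[leb]_t f t = \int[leb]_(t in `[- half_period w N, half_period w N]) f t.
  move=> f0; rewrite [RHS]Rintegral_mkcond; apply: eq_Rintegral => t _.
  rewrite patchE; case: ifPn => // tA; apply/f0/off.
  by apply: contra tA => tA; rewrite inE.
rewrite /phi_tilde /inv_fourier /cintegral.
under eq_Rintegral do rewrite E.
under [X in _ +i* X]eq_Rintegral do rewrite E.
rewrite !restr; last 2 first.
- by move=> t ->; rewrite mul0r.
- by move=> t ->; rewrite mul0r.
have mE (c x z : R) : c%:C * (x +i* z) = (c * x) +i* (c * z).
  by apply/eqP; rewrite eq_complex ReMc ImMc /= !mul0r subr0 addr0 !eqxx.
rewrite mE /osc_re /osc_im.
under eq_Rintegral do rewrite ReMc.
by under [X in _ +i* (_ * X)]eq_Rintegral do rewrite ImMc.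
Qed.

(** The band [a] enters through [delta] only, a lower bound of the denominator; the
    length of the interval of integration comes from [a0].  This is what allows
    a constant that does not depend on [a]. *)
Lemma sum_sqr_phi_tilde (s : seq int) (y : R) : uniq s ->
  \sum_(k <- s) (complex.Re (phi_tilde phi err j k y) ^+ 2 +
                 complex.Im (phi_tilde phi err j k y) ^+ 2) <= (2 * N%:R * l / del) ^+ 2.
Proof.
move=> us; have [mh1 mh2] := mh.
have := sum_sqr_osc mh1 mh2 hK K0 w0 N0 y us.
rewrite -(@ler_pM2l _ ((2 * pi)^-1 ^+ 2)) ?exprn_gt0 ?invr_gt0 ?mulr_gt0 ?pi_gt0//.
have alg (n l' w' d' p : R) : 0 < d' -> 0 < w' -> 0 < p ->
    (2 * p)^-1 ^+ 2 * (2 * (n * p / w') * (2 * l' * w' / d')) ^+ 2 = (2 * n * l' / d') ^+ 2.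
  by move=> d0 w'0 p0; field; rewrite !gt_eqF.
rewrite [X in _ <= X -> _](alg _ _ _ _ _ del0 w0 (pi_gt0 R)).
apply: le_trans; rewrite mulr_sumr; apply: ler_sum => k _.
by rewrite phi_tildeE /= le_eqVlt; apply/orP; left; apply/eqP; ring.
Qed.

Lemma phi_tilde_shift k m y :
  phi_tilde phi err j k (y + m%:~R * 2 `^ (- j)) = phi_tilde phi err j (k - m) y.
Proof. by rewrite !phi_tildeE osc_re_shift osc_im_shift. Qed.

Lemma phi_tilde_lipschitz : exists L : R, 0 <= L /\ forall k y y',
  `|complex.Re (phi_tilde phi err j k y) - complex.Re (phi_tilde phi err j k y')| <=
    L * `|y - y'| /\
  `|complex.Im (phi_tilde phi err j k y) - complex.Im (phi_tilde phi err j k y')| <=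
    L * `|y - y'|.
Proof.
have [mh1 mh2] := mh.
have p0 : 0 < (2 * pi)^-1 :> R by rewrite invr_gt0 mulr_gt0 ?pi_gt0.
exists ((2 * pi)^-1 * osc_lipschitz_constant K w N); split.
  have := half_period_gt0 w0 N0 => A0.
  have A0' := ltW A0; rewrite mulr_ge0 ?(ltW p0)// /osc_lipschitz_constant.
  exact: (mulr_ge0 (mulr_ge0 (mulr_ge0 (ler0n R 2) K0) A0') (mulr_ge0 (ler0n R 2) A0')).
move=> k y y'; rewrite !phi_tildeE /= -!mulrBr !normrM (gtr0_norm p0) -mulrA !ler_pM2l//.
by split; [exact: osc_re_lipschitz|exact: osc_im_lipschitz].
Qed.

End deconvolved_scaling_function.

(** * The law of a sum of independent variables *)

Section density_of_sum.
Context {R : realType} {d : measure_display} {T : measurableType d}.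
Local Notation leb := (@lebesgue_measure R).
Variables (P : probability T R) (X eps : {RV P >-> R}) (err : probability R R).
Variables (f : R -> R) (M : R).
Hypotheses (densX : has_density P X f) (fM : forall x, f x <= M).
Hypothesis law_eps : forall A : set R, measurable A -> distribution P eps A = err A.
Hypothesis indep : independent2 P X eps.

Let mf : measurable_fun setT f. Proof. by case: densX. Qed.
Let f0 x : 0 <= f x. Proof. by case: densX. Qed.

Lemma integral_density (h : R -> R) : measurable_fun setT h -> (forall x, 0 <= h x) ->
  (\int[distribution P X]_x (h x)%:E = \int[leb]_x (h x * f x)%:E)%E.
Proof.
move=> mh h0.
rewrite (@ge0_integral_transfer R _ _ (measurableTypeR R) R leb (distribution P X)
  (fun x => x) f 1)//; first by rewrite mul1e.
move=> B mB; rewrite mul1e; case: densX => _ _ densE.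
transitivity (\int[leb]_(x in B) (f x)%:E)%E; last exact: esym (densE B mB).
rewrite [RHS]integral_mkcond.
apply: eq_integral => x _; rewrite patchE indicE.
by case: ifPn => _; rewrite ?mul1r ?mul0r.
Qed.

Lemma integral_sum_independent (h : R -> R) : measurable_fun setT h -> (forall x, 0 <= h x) ->
  (\int[P]_w (h (X w + eps w))%:E =
   \int[err]_e \int[distribution P X]_x (h (x + e))%:E)%E.
Proof.
move=> mh h0.
pose XE w : R * R := (X w, eps w).
have mXE : measurable_fun setT XE by apply/measurable_fun_pairP; split.
have mhD : measurable_fun setT (fun z : R * R => (h (z.1 + z.2))%:E).
  apply/measurable_EFinP; apply: measurableT_comp => //.
  by apply: measurable_funD.
pose joint : {measure set (R * R) -> \bar R} := pushforward P XE.
transitivity (\int[joint mXE]_z (h (z.1 + z.2))%:E)%E.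
  by rewrite ge0_integral_pushforward// => z _; rewrite lee_fin.
transitivity (\int[distribution P X \x err]_z (h (z.1 + z.2))%:E)%E.
  apply: eq_measure_integral => A mA _; apply/esym.
  apply: product_measure_unique => // B C mB mC.
  transitivity (distribution P X B * distribution P eps C)%E; first exact: indep.
  by congr (_ * _)%E; exact: law_eps.
by rewrite fubini_tonelli2// => z; rewrite lee_fin.
Qed.

Let g := convolution err f.

Let mfB y : measurable_fun setT (fun e : R => f (y - e)).
Proof. by apply: measurableT_comp => //; exact: measurable_funB. Qed.

Let M0 : 0 <= M. Proof. exact: le_trans (f0 0) (fM 0). Qed.

Let fB y : err.-integrable setT (EFin \o (fun e => f (y - e))).
Proof.
by apply: (@bounded_integrable _ _ _ _ _ M) => // e; rewrite ger0_norm.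
Qed.

Lemma convolution_bounds y : 0 <= g y <= M.
Proof.
rewrite Rintegral_ge0//= (le_trans (ler_norm _))//.
by apply: normr_Rintegral_bounded => // e; rewrite ger0_norm.
Qed.

Lemma integral_convolution y : (\int[err]_e (f (y - e))%:E = (g y)%:E)%E.
Proof. by rewrite fineK//; have := integrable_fin_num measurableT (fB y). Qed.

Lemma measurable_shear (k : R -> R) : measurable_fun setT k ->
  measurable_fun setT (fun z : R * R => k (z.1 - z.2)).
Proof. by move=> mk; apply: measurableT_comp => //; exact: measurable_funB. Qed.

Lemma measurable_convolution : measurable_fun setT g.
Proof.
apply/measurable_EFinP.
rewrite (_ : _ \o _ = fubini_F err (fun z : R * R => (f (z.1 - z.2))%:E)); last first.
  by apply/funext => y /=; rewrite -integral_convolution.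
apply: measurable_fun_fubini_tonelli_F.
- by apply/measurable_EFinP; exact: measurable_shear.
- by move=> z; rewrite lee_fin.
Qed.

Lemma Linfty_norm_convolution : 0 <= Linfty_norm g /\
  (\forall y \ae leb, g y <= Linfty_norm g).
Proof.
have leb0 : (0 < leb [set: R])%E.
  by rewrite -set_itvNyy lebesgue_measure_itv/= ltry.
have ubM : (ess_sup leb (abse \o (EFin \o g)) <= M%:E)%E.
  apply/ess_supP; apply: aeW => y /=; have /andP[g0 gM] := convolution_bounds y.
  by rewrite lee_fin ger0_norm.
have lb0 : (0 <= ess_sup leb (abse \o (EFin \o g)))%E.
  by apply: ess_sup_gee => //; apply: aeW => y; exact: abse_ge0.
have fin : ess_sup leb (abse \o (EFin \o g)) \is a fin_num.
  by rewrite ge0_fin_numE// (le_lt_trans ubM)// ltry.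
rewrite /Linfty_norm unlock leb0; split; first exact: fine_ge0.
have := ess_sup_ge leb (abse \o (EFin \o g)).
apply: filterS => y /=; rewrite -{1}(fineK fin) lee_fin => ge.
by rewrite (le_trans (ler_norm _) ge).
Qed.

(** By Fubini's theorem and the invariance of the Lebesgue measure, [g] is a
    density of [X + eps]. *)
Lemma expectation_le_Linfty (h : R -> R) : measurable_fun setT h -> (forall x, 0 <= h x) ->
  (\int[P]_w (h (X w + eps w))%:E <= (Linfty_norm g)%:E * \int[leb]_y (h y)%:E)%E.
Proof.
move=> mh h0; have [G0 gG] := Linfty_norm_convolution.
rewrite integral_sum_independent//.
have -> : (\int[err]_e \int[distribution P X]_x (h (x + e))%:E =
    \int[err]_e \int[leb]_y (h y * f (y - e))%:E)%E.
  apply: eq_integral => e _; rewrite (integral_density (h := fun x => h (x + e)))//;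
    last first.
    by apply: measurableT_comp => //; exact: measurable_funD.
  rewrite -(@ge0_integral_translation _ e (fun y => (h y * f (y - e))%:E)).
  - by apply: eq_integral => x _; rewrite addrK.
  - apply/measurable_EFinP; apply: measurable_funM => //.
    by apply: measurableT_comp => //; exact: measurable_funB.
  - by move=> x; rewrite lee_fin mulr_ge0.
rewrite -(@fubini_tonelli _ _ (measurableTypeR R) R R leb err
  (fun z => (h z.1 * f (z.1 - z.2))%:E)); last 2 first.
- apply/measurable_EFinP; apply: measurable_funM; last exact: measurable_shear.
  exact: measurableT_comp.
- by move=> z; rewrite lee_fin mulr_ge0.
have -> : (\int[leb]_y \int[err]_e (h y * f (y - e))%:E = \int[leb]_y (h y * g y)%:E)%E.
  apply: eq_integral => y _; under eq_integral do rewrite EFinM.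
  rewrite ge0_integralZl//; last 3 first.
  - exact/measurable_EFinP.
  - by move=> e _; rewrite lee_fin.
  - by rewrite lee_fin.
  by rewrite integral_convolution.
rewrite -ge0_integralZl//; last 2 first.
- exact/measurable_EFinP.
- by move=> *; rewrite lee_fin.
apply: ae_ge0_le_integral => //.
- move=> y _; rewrite lee_fin mulr_ge0//.
  by have /andP[] := convolution_bounds y.
- by apply/measurable_EFinP; apply: measurable_funM => //; exact: measurable_convolution.
- by move=> y _; rewrite mule_ge0 ?lee_fin.
- by apply: measurable_funeM; exact/measurable_EFinP.
- case: gG => N [mN N0 gN]; exists N; split => // y /= nle; apply: gN => /= gy.
  by apply: nle => _; rewrite -EFinM lee_fin mulrC ler_wpM2r.
Qed.

End density_of_sum.

(** * Absolutely summable families *)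

Section absolutely_summable_families.
Context {R : realType}.
Implicit Types (v al u : int -> R).

Lemma sum_le_esum v (s : seq int) : (forall k, 0 <= v k) -> uniq s ->
  ((\sum_(k <- s) v k)%:E <= \esum_(k in [set: int]) (v k)%:E)%E.
Proof.
move=> v0 us; apply: esum_ge; exists [set` s]; first by split => //; exact: finite_seq.
by rewrite -fsbig_seq// sumEFin.
Qed.

Lemma esum_le v (x : R) :
  (forall s, uniq s -> \sum_(k <- s) v k <= x) ->
  (\esum_(k in [set: int]) (v k)%:E <= x%:E)%E.
Proof.
move=> vx; apply: ge_ereal_sup => _ [A [finA _] <-].
by rewrite fsbig_finite// sumEFin lee_fin; exact/vx/finmap.fset_uniq.
Qed.

(** What [v] leaves outside of [s] is at most [c] times what [al] leaves there, and
    this is at most [e] as [s] almost exhausts the sum of [al]. *)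
Lemma fine_esum_approx v al (s : seq int) (T c e : R) : uniq s ->
  (forall s', uniq s' -> \sum_(k <- s') al k <= T) ->
  T - e <= \sum_(k <- s) al k ->
  0 <= c -> (forall k, 0 <= v k <= c * al k) ->
  0 <= fine (\esum_(k in [set: int]) (v k)%:E) - \sum_(k <- s) v k <= c * e.
Proof.
move=> us sT Ts c0 vc; have v0 k : 0 <= v k by have /andP[] := vc k.
have up : (\esum_(k in [set: int]) (v k)%:E <= (\sum_(k <- s) v k + c * e)%:E)%E.
  apply: esum_le => f uf; rewrite (bigID (mem s))/=.
  rewrite lerD//.
    rewrite -big_filter; apply: ler_sum_uniq_subset => //; first exact: filter_uniq.
    by move=> k; rewrite mem_filter => /andP[].
  rewrite -big_filter; set f' := [seq k <- f | _].
  have uc : uniq (s ++ f').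
    rewrite cat_uniq us filter_uniq// andbT; apply/hasPn => k.
    by rewrite mem_filter => /andP[].
  have := sT _ uc; rewrite big_cat/= => H.
  apply: (@le_trans _ _ (c * \sum_(k <- f') al k)).
    by rewrite mulr_sumr; apply: ler_sum => k _; have /andP[] := vc k.
  by rewrite ler_wpM2l//; lra.
have low := sum_le_esum v0 us.
move: up low; case: (\esum_(k in _) _)%E => [x| |].
- by rewrite !lee_fin /= => h1 h2; lra.
- by rewrite leye_eq.
- by move=> _; rewrite leeNy_eq.
Qed.

(** The set [s] depends on the weights [al] only.  This uniformity over all the
    families that are dominated by [al] is a substitute for the linearity of
    [zsum], and it also lets [zsum] commute with integrals. *)
Lemma zsum_approx al (T : R) : (\esum_(k in [set: int]) `|al k|%:E <= T%:E)%E ->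
  forall e, 0 < e -> exists2 s : seq int, uniq s &
  forall u c, 0 <= c -> (forall k, `|u k| <= c * `|al k|) ->
  `|zsum u - \sum_(k <- s) u k| <= c * e.
Proof.
move=> alT e e0.
have al0 : (0 <= \esum_(k in [set: int]) `|al k|%:E)%E.
  by apply: esum_ge0 => k _; rewrite lee_fin.
have afin : (\esum_(k in [set: int]) `|al k|%:E)%E \is a fin_num.
  by rewrite ge0_fin_numE// (le_lt_trans alT)// ltry.
have [_ [A [finA _] <-]] := ub_ereal_sup_adherent e0 afin.
rewrite -/(esum _ _) -(fineK afin); set T' := fine _ => Ae.
pose s := finmap.enum_fset (fset_set A).
have us : uniq s by exact: finmap.fset_uniq.
exists s => //.
move=> u c c0 uc.
have sT' s' : uniq s' -> \sum_(k <- s') `|al k| <= T'.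
  by move=> us'; rewrite -lee_fin /T' fineK//; exact: sum_le_esum.
have T'e : T' - e <= \sum_(k <- s) `|al k|.
  by move: Ae; rewrite fsbig_finite// sumEFin -EFinB lte_fin => /ltW.
have split k : u k = Num.max (u k) 0 - Num.max (- u k) 0.
  by rewrite !maxEle; case: ifP; case: ifP; lra.
have hp := @fine_esum_approx (fun k => Num.max (u k) 0) _ _ _ c _ us sT' T'e c0.
have hn := @fine_esum_approx (fun k => Num.max (- u k) 0) _ _ _ c _ us sT' T'e c0.
have {}hp : 0 <= fine (\esum_(k in [set: int]) (Num.max (u k) 0)%:E) -
    \sum_(k <- s) Num.max (u k) 0 <= c * e.
  apply: hp => k; rewrite le_max lexx orbT/= ge_max mulr_ge0// andbT.
  exact: le_trans (ler_norm _) (uc k).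
have {}hn : 0 <= fine (\esum_(k in [set: int]) (Num.max (- u k) 0)%:E) -
    \sum_(k <- s) Num.max (- u k) 0 <= c * e.
  apply: hn => k; rewrite le_max lexx orbT/= ge_max mulr_ge0// andbT.
  by rewrite (le_trans (ler_norm _))// normrN.
rewrite (eq_bigr _ (fun k _ => split k)) sumrB /zsum.
have -> : (\esum_(k in [set: int]) ((EFin \o u)^\+ k) =
  \esum_(k in [set: int]) (Num.max (u k) 0)%:E)%E.
  by apply: eq_esum => k _; rewrite funeposE/= EFin_max.
have -> : (\esum_(k in [set: int]) ((EFin \o u)^\- k) =
  \esum_(k in [set: int]) (Num.max (- u k) 0)%:E)%E.
  by apply: eq_esum => k _; rewrite funenegE/= EFin_max.
move: hp hn => /andP[p1 p2] /andP[q1 q2].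
by rewrite ler_norml; apply/andP; split; lra.
Qed.

End absolutely_summable_families.

(** * Kernels built from summable weights *)

Section summed_family.
Context {R : realType}.
Variables (al : int -> R) (B : R).
Hypothesis alB : (\esum_(k in [set: int]) `|al k|%:E <= B%:E)%E.
Variables (A : int -> R -> R) (b L : R).
Hypothesis Ab : forall k y, `|A k y| <= b.
Hypothesis AL : forall k y y', `|A k y - A k y'| <= L * `|y - y'|.

Definition summed_family (y : R) : R := zsum (fun k => al k * A k y).

Let b0 : 0 <= b. Proof. exact: le_trans (normr_ge0 _) (Ab 0 0). Qed.

Let sum_al_le (s : seq int) : uniq s -> \sum_(k <- s) `|al k| <= B.
Proof.
by move=> us; rewrite -lee_fin (le_trans _ alB)//; exact: sum_le_esum.
Qed.

Let B0 : 0 <= B. Proof. by have := @sum_al_le [::] isT; rewrite big_nil. Qed.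

Let approx e : 0 < e -> exists2 s : seq int, uniq s &
  forall y, `|summed_family y - \sum_(k <- s) al k * A k y| <= e.
Proof.
move=> e0.
have e1 : 0 < e / (b + 1) by rewrite divr_gt0// ltr_wpDl.
have [s us sP] := zsum_approx alB e1; exists s => // y.
rewrite (le_trans (sP (fun k => al k * A k y) b b0 _))//.
  by move=> k; rewrite normrM mulrC ler_wpM2r.
rewrite mulrCA ler_piMr ?(ltW e0)// ler_pdivrMr ?mul1r ?lerDl//.
by rewrite ltr_wpDl.
Qed.

Let weighted_le (s : seq int) (v : int -> R) (r : R) : uniq s -> (forall k, `|v k| <= r) ->
  `|\sum_(k <- s) al k * v k| <= B * r.
Proof.
move=> us vr; have r0 : 0 <= r by exact: le_trans (normr_ge0 _) (vr 0).
rewrite (le_trans (ler_norm_sum _ _ _))// (@le_trans _ _ (\sum_(k <- s) `|al k| * r))//.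
  by apply: ler_sum => k _; rewrite normrM ler_wpM2l.
by rewrite -mulr_suml ler_wpM2r// sum_al_le.
Qed.

Lemma summed_family_lipschitz y y' :
  `|summed_family y - summed_family y'| <= B * L * `|y - y'|.
Proof.
apply/ler_addgt0Pr => e e0.
have [s us sP] := approx (divr_gt0 e0 (ltr0n R 2)).
have := weighted_le us (fun k => AL k y y').
under eq_bigr do rewrite mulrBr.
rewrite sumrB mulrA => H; have := sP y; have := sP y'.
move: H; rewrite !ler_norml => /andP[a1 a2] /andP[c1 c2] /andP[d1 d2].
by apply/andP; split; lra.
Qed.

Lemma measurable_summed_family : measurable_fun setT summed_family.
Proof. exact: lipschitz_measurable summed_family_lipschitz. Qed.

Lemma summed_family_bounded y : `|summed_family y| <= B * b.
Proof.
apply/ler_addgt0Pr => e e0; have [s us sP] := approx e0.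
have := weighted_le us (fun k => Ab k y); have := sP y.
rewrite !ler_norml => /andP[a1 a2] /andP[c1 c2].
by apply/andP; split; lra.
Qed.

(** The supremum over the weights has disappeared from the right-hand side: it
    is enough to control the deviations of the members of the family. *)
Lemma summed_family_deviation (mu : probability R R) (I : finType) (y : I -> R) (r : R) :
  (forall k, `|\sum_i (A k (y i) - \int[mu]_z A k z)| <= r) ->
  `|\sum_i (summed_family (y i) - \int[mu]_z summed_family z)| <= B * r.
Proof.
move=> Ar; apply/ler_addgt0Pr => e e0.
pose n : R := #|I|%:R.
have n0 : 0 < 2 * n + 1 by rewrite ltr_wpDl// mulr_ge0.
have e1 : 0 < e / (2 * n + 1) by rewrite divr_gt0.
have [s us sP] := approx e1; set e' := e / _ in e1 sP.
pose S y := \sum_(k <- s) al k * A k y.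
have mA k : measurable_fun setT (A k) := lipschitz_measurable (AL k).
have bA k : bounded_measurable (fun z => al k * A k z).
  by apply: bounded_measurableM; [exact: bounded_measurable_cst|split => //; exists b].
have bS : bounded_measurable S by exact: bounded_measurable_sum.
have bT : bounded_measurable summed_family.
  split; first exact: measurable_summed_family.
  by exists (B * b); exact: summed_family_bounded.
have muT : (mu setT < +oo)%E by rewrite (@le_lt_trans _ _ 1%E) ?probability_le1 ?ltry.
have intS : \int[mu]_z S z = \sum_(k <- s) al k * \int[mu]_z A k z.
  rewrite bounded_Rintegral_sum//; apply: eq_bigr => k _.
  by rewrite bounded_RintegralZ//; split => //; exists b.
have intD : `|\int[mu]_z summed_family z - \int[mu]_z S z| <= e'.
  rewrite -bounded_RintegralB//; apply: normr_Rintegral_bounded => //.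
  by case: (bounded_measurableB bT bS).
have -> : \sum_i (summed_family (y i) - \int[mu]_z summed_family z) =
    \sum_(k <- s) al k * \sum_i (A k (y i) - \int[mu]_z A k z) +
    \sum_i ((summed_family (y i) - S (y i)) -
            (\int[mu]_z summed_family z - \int[mu]_z S z)).
  under [X in _ = X + _]eq_bigr do rewrite mulr_sumr.
  rewrite exchange_big/= -big_split/=; apply: eq_bigr => i _.
  rewrite [X in _ = X + _](_ : _ = S (y i) - \int[mu]_z S z); first by ring.
  by rewrite intS /S -sumrB; apply: eq_bigr => k _; rewrite mulrBr.
rewrite (le_trans (ler_normD _ _))// lerD//; first exact: weighted_le.
rewrite (le_trans (ler_norm_sum _ _ _))//.
apply: (@le_trans _ _ (\sum_(i : I) 2 * e')).
  apply: ler_sum => i _; rewrite (le_trans (ler_normB _ _))//.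
  by rewrite mulr_natl mulr2n lerD//; exact: sP.
have -> : \sum_(i : I) 2 * e' = e * (2 * n / (2 * n + 1)).
  transitivity (2 * e' * n); first by rewrite sumr_const mulr_natr.
  by rewrite /e'; move: (n) n0 => m m0; field; rewrite gt_eqF.
by rewrite ler_piMr ?(ltW e0)// ler_pdivrMr// mul1r lerDl.
Qed.

End summed_family.

Section supremum_of_lipschitz.
Context {R : realType} {d : measure_display} {T : measurableType d} {I : finType}.

(** The supremum may run over uncountably many functions; a common Lipschitz
    constant makes its superlevel sets countable unions of preimages of balls
    with rational centres. *)
Lemma measurable_sup_lipschitz (J : Type) (G : J -> (I -> R) -> R) (C : R)
    (Y : I -> T -> R) :
  0 <= C -> (forall x y y', `|G x y - G x y'| <= C * \sum_i `|y i - y' i|) ->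
  (forall i, measurable_fun setT (Y i)) ->
  measurable_fun setT (fun w => ereal_sup (range (fun x => (G x (Y ^~ w))%:E))).
Proof.
move=> C0 GL mY mT; apply: (measurability _ (ErealGenOInfty.measurableE R)) => //.
move=> _ [_ [c ->] <-]; rewrite setTI.
pose n : R := #|I|%:R.
have n0 : 0 <= n by rewrite /n.
pose rad (N : nat) : R := N.+1%:R^-1.
have rad0 N : 0 < rad N by rewrite invr_gt0.
(* [U z] is the ball around the rational point [z.1], provided that some [G x] is so
   large at its centre that it exceeds [c] on the whole ball. *)
pose U (z : {ffun I -> rat} * nat) := if `[< exists x,
  c + C * n * rad z.2 < G x (fun i => ratr (z.1 i)) >]
  then \bigcap_(i in [set: I]) (Y i @^-1` ball (ratr (z.1 i) : R) (rad z.2)) else set0.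
have sumle (y y' : I -> R) r : (forall i, `|y i - y' i| <= r) ->
    C * \sum_i `|y i - y' i| <= C * n * r.
  move=> yr; rewrite -mulrA ler_wpM2l// (@le_trans _ _ (\sum_(i : I) r))//.
    by apply: ler_sum.
  by rewrite sumr_const mulr_natl.
rewrite (_ : _ @^-1` _ = \bigcup_z U z).
  apply: countable_bigcupT_measurable; first exact: countableP.
  move=> z; rewrite /U; case: ifP => _ //.
  apply: fin_bigcap_measurable; first exact: finite_finset.
  move=> i _; rewrite -[X in measurable X]setTI; apply: mY => //.
  exact: measurable_ball.
apply/seteqP; split => w /=.
  rewrite in_itv/= andbT => /ereal_sup_gt[_ [x _ <-]]; rewrite lte_fin => cG.
  have e0 : 0 < G x (Y^~ w) - c by rewrite subr_gt0.
  have k0 : 0 < 2 * (C * n) + 1 by rewrite ltr_wpDl// !mulr_ge0.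
  have [N _ /(_ N (leqnn _)) NP] := near_infty_natSinv_lt (PosNum (divr_gt0 e0 k0)).
  have NP' : 2 * (C * n) * rad N < G x (Y^~ w) - c.
    move: NP; rewrite /= -/(rad N) ltr_pdivlMr// mulrDr mulr1 => NP.
    by rewrite (le_lt_trans _ NP)// mulrC lerDl ltW.
  have /choice[q qP] : forall i, exists q : rat, `|Y i w - ratr q| < rad N.
    move=> i; have : Y i w - rad N < Y i w + rad N by rewrite ltrBlDr -addrA ltrDl addr_gt0.
    move=> /rat_in_itvoo[q]; rewrite in_itv/= => /andP[q1 q2]; exists q.
    by rewrite ltr_norml; apply/andP; split; lra.
  exists ([ffun i => q i], N) => //; rewrite /U asboolT; last first.
    exists x; have := GL x (Y^~ w) (fun i => ratr ([ffun i => q i] i)).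
    have H1 : C * (\sum_i `|Y i w - ratr ([ffun i => q i] i)|) <= C * n * rad N.
      by apply: sumle => i; rewrite ffunE ltW.
    rewrite ler_norml => /andP[_ H2] /=; lra.
  move=> i _ /=; rewrite ffunE -ball_normE/= distrC; exact: qP.
move=> [[q N] _]; rewrite /U; case: asboolP => // -[x cG] wq.
rewrite in_itv/= andbT; apply: (@lt_le_trans _ _ (G x (Y^~ w))%:E); last first.
  by apply: ereal_sup_ubound; exists x.
rewrite lte_fin.
have H1 : C * (\sum_i `|Y i w - ratr (q i)|) <= C * n * rad N.
  apply: sumle => i; have := wq i Logic.I; rewrite /= -ball_normE/= distrC; exact: ltW.
have := GL x (Y^~ w) (fun i => ratr (q i)); rewrite ler_norml => /andP[H2 _].
by move: cG => /= cG; lra.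
Qed.

End supremum_of_lipschitz.

(** * Deviations of the estimator *)

Section complex_norm.
Local Open Scope complex_scope.
Context {R : realType}.

Lemma cabsD (z w : R[i]) : cabs (z + w) <= cabs z + cabs w.
Proof.
have := ler_normD z w.
by case: z w => [a b] [c d] /andP[_].
Qed.

Lemma cabs_lipschitz (z w : R[i]) : `|cabs z - cabs w| <= cabs (z - w).
Proof.
have cN (u v : R[i]) : cabs (u - v) = cabs (v - u).
  by rewrite !cabsE; case: u v => [a b] [c d] /=; congr Num.sqrt; ring.
have h1 := cabsD (z - w) w; have h2 := cabsD (w - z) z.
rewrite !subrK cN in h1 h2.
by rewrite ler_norml; apply/andP; split; rewrite ?(cN z w); lra.
Qed.

Lemma mul_real_complex (c x y : R) : c%:C * (x +i* y) = (c * x) +i* (c * y).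
Proof. by apply/eqP; rewrite eq_complex ReMc ImMc /= !mul0r subr0 addr0 !eqxx. Qed.

Lemma sum_complex (I : Type) (s : seq I) (f g : I -> R) :
  \sum_(i <- s) (f i +i* g i) = (\sum_(i <- s) f i) +i* (\sum_(i <- s) g i).
Proof. by elim: s => [|i s IH]; rewrite ?big_nil// !big_cons IH. Qed.

End complex_norm.

Section common_law.
Local Open Scope complex_scope.
Context {R : realType} {d : measure_display} {T : measurableType d}.
Variables (P : probability T R) (Y : {RV P >-> R}) (mu : probability R R).
Hypothesis lawY : forall A : set R, measurable A -> distribution P Y A = mu A.

Lemma Rintegral_law (g : R -> R) : bounded_measurable g ->
  \int[P]_w g (Y w) = \int[mu]_y g y.
Proof.
move=> [mg [M gM]]; rewrite /Rintegral; congr fine.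
transitivity (\int[distribution P Y]_y (g y)%:E)%E.
  rewrite integral_distribution//; first exact/measurable_EFinP.
  by apply: (@bounded_integrable _ _ _ _ _ M) => //; exact: measurableT_comp.
by apply: eq_measure_integral => A mA _; exact: lawY.
Qed.

End common_law.

Section deviations.
Local Open Scope complex_scope.
Context {R : realType}.
Variables (phi : R -> R) (err : probability R R) (j B : R).
Hypothesis sumB : forall x : R, (\esum_(k in [set: int]) `|translate phi k x|%:E <= B%:E)%E.
Let A1 k y := complex.Re (phi_tilde phi err j k y).
Let A2 k y := complex.Im (phi_tilde phi err j k y).
Variables (b L : R).
Hypotheses (A1b : forall k y, `|A1 k y| <= b) (A2b : forall k y, `|A2 k y| <= b).
Hypotheses (A1L : forall k y y', `|A1 k y - A1 k y'| <= L * `|y - y'|).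
Hypotheses (A2L : forall k y y', `|A2 k y - A2 k y'| <= L * `|y - y'|).
Hypothesis L0 : 0 <= L.

Let al x k := translate phi k (2 `^ j * x).
Let T1 x := summed_family (al x) A1.
Let T2 x := summed_family (al x) A2.

Let B0 : 0 <= B.
Proof. by rewrite -lee_fin (le_trans _ (sumB 0))// esum_ge0. Qed.

Lemma deconv_kernelE x y :
  deconv_kernel phi err j x y = (2 `^ j * T1 x y) +i* (2 `^ j * T2 x y).
Proof.
have ReZ (c : R) z : complex.Re (c%:C * z) = c * complex.Re z.
  by rewrite ReMc /= mul0r subr0.
have ImZ (c : R) z : complex.Im (c%:C * z) = c * complex.Im z.
  by rewrite ImMc /= mul0r addr0.
rewrite /deconv_kernel /zcsum mul_real_complex.
under eq_fun do rewrite ReZ.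
by under [X in _ +i* (_ * zsum X)]eq_fun do rewrite ImZ.
Qed.

Context {d : measure_display} {T : measurableType d} {P : probability T R}.
Variables (n : nat) (Y : 'I_n -> {RV P >-> R}) (mu : probability R R).
Hypothesis lawY : forall i (A : set R), measurable A -> distribution P (Y i) A = mu A.

Let dev x (y : 'I_n -> R) : R[i] :=
  (n%:R^-1 * 2 `^ j * \sum_i (T1 x (y i) - \int[mu]_z T1 x z)) +i*
  (n%:R^-1 * 2 `^ j * \sum_i (T2 x (y i) - \int[mu]_z T2 x z)).

Lemma estimator_deviationE x w :
  estimator phi err j (Y ^~ w) x -
  cintegral P (fun w' => estimator phi err j (Y ^~ w') x) = dev x (Y ^~ w).
Proof.
have bT1 : bounded_measurable (T1 x).
  split; first exact: (measurable_summed_family (sumB _) A1b A1L).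
  by exists (B * b) => y; exact: (summed_family_bounded (sumB _) A1b).
have bT2 : bounded_measurable (T2 x).
  split; first exact: (measurable_summed_family (sumB _) A2b A2L).
  by exists (B * b) => y; exact: (summed_family_bounded (sumB _) A2b).
have estE (y : 'I_n -> R) : estimator phi err j y x =
    (n%:R^-1 * 2 `^ j * \sum_i T1 x (y i)) +i* (n%:R^-1 * 2 `^ j * \sum_i T2 x (y i)).
  rewrite /estimator; under eq_bigr do rewrite deconv_kernelE.
  rewrite [X in X * _ = _](_ : _ = (n%:R^-1)%:C); last by rewrite fmorphV rmorph_nat.
  by rewrite sum_complex -!mulr_sumr mul_real_complex !mulrA.
have intE (Tx : R -> R) : bounded_measurable Tx ->
    \int[P]_w' (n%:R^-1 * 2 `^ j * \sum_i Tx (Y i w')) =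
    n%:R^-1 * 2 `^ j * \sum_(i < n) \int[mu]_z Tx z.
  move=> bTx; have bTY i : bounded_measurable (fun w' => Tx (Y i w')).
    case: bTx => mTx [M TM]; split; first exact: measurableT_comp.
    by exists M => w'; exact: TM.
  have PT : (P setT < +oo)%E by rewrite (@le_lt_trans _ _ 1%E) ?probability_le1 ?ltry.
  rewrite bounded_RintegralZ//; last exact: bounded_measurable_sum.
  rewrite bounded_Rintegral_sum//; congr (_ * _); apply: eq_bigr => i _.
  exact: (Rintegral_law (@lawY i) bTx).
rewrite /cintegral estE.
under eq_Rintegral do rewrite estE /=.
under [X in _ - (_ +i* X)]eq_Rintegral do rewrite estE /=.
rewrite !intE// /dev !sumrB !mulrBr.
by apply/eqP; rewrite eq_complex /= !eqxx.
Qed.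

Lemma sup_deviationE w : sup_deviation phi err j P (fun m => Y m : T -> R) w =
  ereal_sup (range (fun x => (cabs (dev x (Y ^~ w)))%:E)).
Proof.
rewrite /sup_deviation.
by rewrite (funext (fun x => congr1 (fun z => (cabs z)%:E) (estimator_deviationE x w))).
Qed.

Lemma measurable_sup_deviation :
  measurable_fun setT (sup_deviation phi err j P (fun m => Y m : T -> R)).
Proof.
rewrite (funext sup_deviationE).
pose c := n%:R^-1 * 2 `^ j; have c0 : 0 <= c by rewrite mulr_ge0 ?invr_ge0 ?powR_ge0.
apply: (@measurable_sup_lipschitz _ _ _ _ _ (fun x y => cabs (dev x y)) (2 * c * (B * L))
  (fun i => Y i)).
- by rewrite !mulr_ge0.
- move=> x y y'; rewrite (le_trans (cabs_lipschitz _ _))//.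
  rewrite (le_trans (cabs_le _))//= -!mulrBr -!sumrB.
  have H (Tx : R -> R) e : (forall y y', `|Tx y - Tx y'| <= B * L * `|y - y'|) ->
      `|c * \sum_i (Tx (y i) - e - (Tx (y' i) - e))| <= c * (B * L) * \sum_i `|y i - y' i|.
    move=> TL; rewrite normrM (ger0_norm c0) -mulrA ler_wpM2l//.
    rewrite (le_trans (ler_norm_sum _ _ _))// mulr_sumr; apply: ler_sum => i _.
    by rewrite opprB addrA subrK; exact: TL.
  rewrite (_ : 2 * c * _ * _ = c * (B * L) * (\sum_i `|y i - y' i|) +
    c * (B * L) * (\sum_i `|y i - y' i|)); last by ring.
  rewrite lerD//; apply: H => z z'.
    exact: (summed_family_lipschitz (sumB _) A1b A1L).
  exact: (summed_family_lipschitz (sumB _) A2b A2L).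
- by move=> i; exact: measurable_funP.
Qed.

Lemma sup_deviation_ge0 w : (0 <= sup_deviation phi err j P (fun m => Y m : T -> R) w)%E.
Proof.
rewrite sup_deviationE; apply: (@le_trans _ _ (cabs (dev 0 (Y^~ w)))%:E).
  by rewrite lee_fin cabsE sqrtr_ge0.
by apply: ereal_sup_ubound; exists 0.
Qed.

Lemma sup_deviation_le w (r : R) :
  (forall k, `|\sum_i (A1 k (Y i w) - \int[mu]_z A1 k z)| <= r) ->
  (forall k, `|\sum_i (A2 k (Y i w) - \int[mu]_z A2 k z)| <= r) ->
  (sup_deviation phi err j P (fun m => Y m : T -> R) w <=
   (2 * (n%:R^-1 * 2 `^ j) * (B * r))%:E)%E.
Proof.
move=> r1 r2; rewrite sup_deviationE; apply: ge_ereal_sup => _ [x _ <-].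
pose c := n%:R^-1 * 2 `^ j; have c0 : 0 <= c by rewrite mulr_ge0 ?invr_ge0 ?powR_ge0.
rewrite lee_fin (le_trans (cabs_le _))//= !normrM -/c.
rewrite -normrM -/c (ger0_norm c0).
rewrite (_ : 2 * c * _ = c * (B * r) + c * (B * r)); last by ring.
rewrite lerD// ler_wpM2l//.
  exact: (summed_family_deviation (sumB _) A1b A1L).
exact: (summed_family_deviation (sumB _) A2b A2L).
Qed.

End deviations.

(** * From an exponential moment to tails and moments *)

Section exponential_bounds.
Context {R : realType}.

Lemma expR1_ge2 : 2 <= expR 1 :> R.
Proof. by have := expR_ge1Dx (1 : R); lra. Qed.

Lemma powR2_le_expR (j : R) : 0 <= j -> 2 `^ j <= expR j.
Proof.
move=> j0; rewrite -[X in expR X]mul1r expRM.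
by apply: ge0_ler_powR => //; rewrite ?nnegrE ?expR_ge0// expR1_ge2.
Qed.

(** The three factors are at most [expR s] each. *)
Lemma exponential_moment_constant (s j : R) : 1 <= s -> 0 <= j -> j <= s ->
  2 + s * 2 `^ j * expR s <= expR (5 * s).
Proof.
move=> s1 j0 js; have E0 := expR_gt0 s.
have sE : s <= expR s by have := expR_ge1Dx s; lra.
have jE : 2 `^ j <= expR s by rewrite (le_trans (powR2_le_expR j0))// ler_expR.
have E2 : 2 <= expR s by rewrite (le_trans expR1_ge2)// ler_expR.
rewrite (expRM_natl 5).
have : s * 2 `^ j * expR s <= expR s ^+ 3.
  rewrite exprS expr2 mulrA mulrC [leRHS]mulrC ler_wpM2l ?(ltW E0)//.
  by rewrite ler_pM ?powR_ge0//; lra.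
move: (expR s) E2 => E E2 H.
have : E ^+ 3 * 4 <= E ^+ 5.
  rewrite (_ : E ^+ 5 = E ^+ 3 * E ^+ 2); last by ring.
  by rewrite ler_wpM2l ?exprn_ge0//; nra.
have : 8 <= E ^+ 3 by rewrite (_ : 8 = 2 ^+ 3 :> R) ?lerXn2r ?nnegrE//; lra.
lra.
Qed.

Definition power_exp_constant (p : R) : R := p `^ p * expR 1.

(** For [rho] above 1, the factor [p `^ p] comes from comparing [rho / p] with its
    exponential. *)
Lemma powR_le_exponential (p rho c : R) : 1 <= p -> 0 <= rho -> 1 <= c ->
  rho `^ p <= 1 + power_exp_constant p * expR (c * (rho - 1)).
Proof.
move=> p1 r0 c1; have p0 : 0 < p by lra.
have K0 : 0 <= power_exp_constant p by rewrite mulr_ge0 ?powR_ge0 ?expR_ge0.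
have [r1|r1] := leP rho 1.
  apply: (@le_trans _ _ 1); last by rewrite lerDl mulr_ge0// expR_ge0.
  have := @ge0_ler_powR R p (ltW p0) rho 1; rewrite !nnegrE powR1; exact.
apply: (@le_trans _ _ (p `^ p * expR rho)).
  have -> : rho `^ p = p `^ p * (rho / p) `^ p.
    rewrite -powRM ?divr_ge0 ?(ltW p0)//; congr (_ `^ _).
    by field; rewrite gt_eqF.
  have -> : expR rho = expR (rho / p) `^ p.
    by rewrite -expRM; congr expR; field; rewrite gt_eqF.
  rewrite ler_wpM2l ?powR_ge0//.
  apply: ge0_ler_powR; rewrite ?nnegrE ?expR_ge0 ?divr_ge0 ?(ltW p0)//.
  by have := expR_ge1Dx (rho / p); lra.
apply: (@le_trans _ _ (power_exp_constant p * expR (c * (rho - 1)))); last by rewrite lerDr.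
rewrite /power_exp_constant -mulrA -expRD ler_wpM2l ?powR_ge0// ler_expR.
nra.
Qed.

End exponential_bounds.

Section bounds_from_exponential_moment.
Context {R : realType} {d : measure_display} {T : measurableType d}.
Variables (P : probability T R) (D W : T -> \bar R) (s c : R).
Hypotheses (mD : measurable_fun setT D) (mW : measurable_fun setT W).
Hypotheses (D0 : forall w, (0 <= D w)%E) (W2 : forall w, (2%:E <= W w)%E).
Hypotheses (s1 : 1 <= s) (c0 : 0 < c).
Hypothesis DW : forall w m, W w = m%:E -> (D w <= (c * ln m / (6 * s))%:E)%E.
Hypothesis EW : (\int[P]_w W w <= (expR (5 * s))%:E)%E.

Let s0 : 0 < s. Proof. exact: lt_le_trans s1. Qed.
Let W0 w : (0 <= W w)%E. Proof. by apply: le_trans (W2 w); rewrite lee_fin. Qed.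

(** Markov's inequality for [W] at the level [expR (6 * s)]. *)
Lemma tail_bound : (P [set w | (c%:E <= D w)] <= (expR (- s))%:E)%E.
Proof.
pose A := [set w | (c%:E <= D w)%E].
have mA : measurable A.
  by have := emeasurable_fun_c_infty measurableT mD c%:E; rewrite setTI.
have AW w : A w -> ((expR (6 * s))%:E <= W w)%E.
  move=> cD; have := W2 w; case E : (W w) => [m||]// m2; last by rewrite leey.
  rewrite lee_fin in m2.
  have := le_trans cD (DW E); rewrite lee_fin -mulrA ler_pMr// ler_pdivlMr ?mulr_gt0// mul1r.
  by move=> h; rewrite lee_fin -[leRHS]lnK ?posrE ?ler_expR//; lra.
have H : ((expR (6 * s))%:E * P A <= (expR (5 * s))%:E)%E.
  rewrite -integral_cst//; apply: le_trans EW.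
  apply: (@le_trans _ _ (\int[P]_(w in A) W w)%E).
    apply: ge0_le_integral => //.
    - by move=> w _; rewrite lee_fin expR_ge0.
    - exact: measurable_funTS.
  by apply: ge0_subset_integral => //.
rewrite -/A (_ : - s = 5 * s - 6 * s); last by ring.
by rewrite expRB EFinM lee_pdivlMr ?expR_gt0// muleC.
Qed.

(** Where [D] exceeds its scale [c], its power is compared with
    [expR (6 * s * (D / c - 1))], which has an expectation of at most [expR (- s)]. *)
Lemma moment_bound (p : R) : 1 <= p ->
  ((\int[P]_w (D w `^ p)) `^ p^-1 <=
   (c * (1 + power_exp_constant p) `^ p^-1)%:E)%E.
Proof.
move=> p1; have p0 : 0 < p by lra.
pose K := power_exp_constant p.
have K0 : 0 <= K by rewrite mulr_ge0 ?powR_ge0 ?expR_ge0.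
pose k := K * expR (- (6 * s)).
have k0 : 0 <= k by rewrite mulr_ge0 ?expR_ge0.
have DWp w : (D w `^ p <= (c `^ p)%:E * (1 + k%:E * W w))%E.
  have := W2 w; case E : (W w) => [m||]// m2; last first.
    have kp : 0 < k by rewrite !mulr_gt0 ?powR_gt0 ?expR_gt0.
    by rewrite gt0_muley ?lte_fin// addey// gt0_muley ?leey// lte_fin powR_gt0.
  rewrite lee_fin in m2.
  have m1 : 0 <= ln m by rewrite ln_ge0//; lra.
  pose rho := ln m / (6 * s).
  have r0 : 0 <= rho by rewrite divr_ge0// mulr_ge0// ltW.
  apply: (@le_trans _ _ (((c * rho)%:E) `^ p)%E).
    apply: gt0_ler_poweR.
    - exact: ltW.
    - by rewrite in_itv/= D0 leey.
    - by rewrite in_itv/= lee_fin mulr_ge0 ?(ltW c0)// leey.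
    - by rewrite /rho mulrA; exact: DW.
  have -> : ((c `^ p)%:E * (1 + k%:E * m%:E) = (c `^ p * (1 + k * m))%:E)%E by [].
  rewrite poweR_EFin lee_fin powRM ?(ltW c0)// ler_wpM2l ?powR_ge0//.
  have s6 : 1 <= 6 * s by have := s1; lra.
  apply: (le_trans (powR_le_exponential p1 r0 s6)); rewrite -/K.
  have -> : expR (6 * s * (rho - 1)) = expR (- (6 * s)) * m.
    rewrite mulrBr mulr1 addrC expRD /rho (mulrC (6 * s) (_ / _)) divfK ?gt_eqF ?mulr_gt0//.
    by rewrite lnK// posrE; lra.
  by rewrite /k mulrA.
have H : (\int[P]_w (D w `^ p) <= (c `^ p * (1 + K))%:E)%E.
  apply: (@le_trans _ _ (\int[P]_w ((c `^ p)%:E * (1 + k%:E * W w)))%E).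
    apply: ge0_le_integral => //.
    - by move=> w _; exact: poweR_ge0.
    - by apply: (measurableT_comp (f := fun x => poweR x p)) => //; exact: measurable_poweR.
    - apply: measurable_funeM; apply: emeasurable_funD => //.
      exact: measurable_funeM.
  rewrite ge0_integralZl//; last 3 first.
  - by apply: emeasurable_funD => //; exact: measurable_funeM.
  - by move=> w _; rewrite adde_ge0// mule_ge0// lee_fin.
  - by rewrite lee_fin powR_ge0.
  rewrite ge0_integralD//; last 2 first.
  - by move=> w _; rewrite mule_ge0// lee_fin.
  - exact: measurable_funeM.
  rewrite integral_cst//= probability_setT mul1e ge0_integralZl// ?lee_fin//.
  rewrite [leRHS]EFinM; apply: lee_wpmul2l; first by rewrite lee_fin powR_ge0.
  rewrite [leRHS]EFinD; apply: leeD => //.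
  apply: (@le_trans _ _ (k%:E * (expR (5 * s))%:E)%E); first exact: lee_wpmul2l.
  rewrite -EFinM lee_fin /k -mulrA -expRD ler_piMr// -[leRHS]expR0 ler_expR; have := s0; lra.
have c1K : 0 <= 1 + K by lra.
apply: (@le_trans _ _ ((c `^ p * (1 + K))%:E `^ p^-1)%E).
  apply: gt0_ler_poweR => //.
  - by rewrite invr_ge0 ltW.
  - by rewrite in_itv/= leey andbT integral_ge0// => w _; exact: poweR_ge0.
  - by rewrite in_itv/= leey andbT lee_fin mulr_ge0 ?powR_ge0.
rewrite poweR_EFin lee_fin powRM ?powR_ge0// -powRrM divff ?gt_eqF// powRr1//.
exact: ltW.
Qed.

End bounds_from_exponential_moment.

(** * The exponential moment of the supremum *)

Section exponential_moment_of_deviation.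
Context {R : realType}.
Variables (phi : R -> R) (err : probability R R) (j B : R).
Hypothesis sumB : forall x : R, (\esum_(k in [set: int]) `|translate phi k x|%:E <= B%:E)%E.
Let A (i : int * bool) y := if i.2 then complex.Re (phi_tilde phi err j i.1 y)
  else complex.Im (phi_tilde phi err j i.1 y).
Variables (b L : R).
Hypotheses (b0 : 0 <= b) (L0 : 0 <= L).
Hypothesis sumA : forall (s : seq int) (y : R), uniq s ->
  \sum_(k <- s) (complex.Re (phi_tilde phi err j k y) ^+ 2 +
                 complex.Im (phi_tilde phi err j k y) ^+ 2) <= b ^+ 2.
Hypothesis lipA : forall i y y', `|A i y - A i y'| <= L * `|y - y'|.

Context {d : measure_display} {T : measurableType d} {P : probability T R}.
Variables (n : nat) (Y : 'I_n -> {RV P >-> R}) (mu : probability R R) (s2 l : R).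
Hypothesis indepY : mutually_independent P (fun i => Y i : T -> R).
Hypothesis lawY : forall i (A : set R), measurable A -> distribution P (Y i) A = mu A.
Hypothesis momA : forall i, \int[mu]_y (A i y ^+ 2) <= s2.
Hypotheses (l0 : 0 < l) (lb : 2 * (l * b) <= 1) (s20 : 0 <= s2).

Local Notation D := (sup_deviation phi err j P (fun m => Y m : T -> R)).

Lemma sum_sqr_components (s : seq (int * bool)) (y : R) : uniq s ->
  \sum_(i <- s) A i y ^+ 2 <= b ^+ 2.
Proof.
move=> us; pose ks := undup [seq i.1 | i <- s].
have uks : uniq ks by exact: undup_uniq.
have upairs : uniq [seq (k, c) | k <- ks, c <- [:: true; false]].
  by apply: allpairs_uniq => // -[k c] [k' c'].
apply: le_trans (sumA y uks).
apply: (@le_trans _ _ (\sum_(i <- [seq (k, c) | k <- ks, c <- [:: true; false]]) A i y ^+ 2)).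
  apply: ler_sum_uniq_subset => // [[k c] kcs|i]; last exact: sqr_ge0.
  apply/allpairsP; exists (k, c); split => //=.
    by rewrite mem_undup; apply/mapP; exists (k, c).
  by rewrite !inE; case: (c).
rewrite big_allpairs/=; apply: ler_sum => k _.
by rewrite !big_cons big_nil addr0.
Qed.

Let Ab i y : `|A i y| <= b.
Proof.
rewrite -(ler_pXn2r (n := 2))// ?nnegrE// real_normK ?num_real//.
by have := @sum_sqr_components [:: i] y isT; rewrite big_seq1.
Qed.

Let mA i : measurable_fun setT (A i) := lipschitz_measurable (lipA i).

Let h k (y : R) := enumerated (A ^~ y) k.

Let hE i : h (pickle i) = A i.
Proof. by apply/funext => y; rewrite /h enumerated_pickle. Qed.

Let h_cases k : (exists i, h k = A i) \/ h k = fun=> 0.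
Proof.
rewrite /h /enumerated; case: (pickle_inv k) => [i|]/=; last by right.
by left; exists i.
Qed.

Let mh k : measurable_fun setT (h k).
Proof. by have [[i ->]|->] := h_cases k; [exact: mA|exact: measurable_cst]. Qed.

Let S k w := \sum_i (h k (Y i w) - \int[mu]_z h k z).

(** [W] is the sum of 2 and of all the two-sided exponentials of the centred sums
    [S k], each diminished by 2.  It dominates [expR (l * `|S k|)] for every [k],
    so its logarithm controls all of the [S k] at once. *)
Lemma exponential_moment_of_deviation : exists W : T -> \bar R,
  [/\ measurable_fun setT W, forall w, (2%:E <= W w)%E,
      (\int[P]_w W w <=
        (2 + 4 * l ^+ 2 * n%:R * b ^+ 2 * expR (2 * l ^+ 2 * n%:R * s2))%:E)%E &
      forall w m, W w = m%:E -> (D w <= (2 * (n%:R^-1 * 2 `^ j) * (B * (ln m / l)))%:E)%E].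
Proof.
pose q k w := expR (l * S k w) + expR (- (l * S k w)) - 2.
have q0 k w : 0 <= q k w by rewrite subr_ge0 expRD_expRN_ge2.
pose V w := (\sum_(k <oo) (q k w)%:E)%E.
have V0 w : (0 <= V w)%E by apply: nneseries_ge0 => k _ _; rewrite lee_fin.
have qV k w : ((q k w)%:E <= V w)%E.
  rewrite /V (@nneseriesD1 _ (fun k => (q k w)%:E) k)//; last first.
    by move=> i _; rewrite lee_fin.
  by rewrite leeDl// nneseries_ge0// => i _ _; rewrite lee_fin.
have mS k : measurable_fun setT (fun w => l * S k w).
  by apply: measurable_funM => //; exact: measurable_centered_sum.
have mq k : measurable_fun setT (fun w => (q k w)%:E).
  apply/measurable_EFinP; apply: measurable_funB => //.
  apply: measurable_funD; first exact: measurableT_comp.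
  by apply: measurableT_comp => //; exact: measurable_funN.
have mV : measurable_fun setT V.
  apply: (@ge0_emeasurable_sum _ _ _ _ (fun k w => (q k w)%:E) xpredT) => //.
  by move=> k w _ _; rewrite lee_fin.
exists (fun w => 2 + V w)%E; split.
- exact: emeasurable_funD.
- by move=> w; rewrite leeDl.
- have := @expR_sup_centered_sum_moment R d T P 'I_n Y mu indepY lawY h b s2 l mh b0.
  rewrite card_ord; apply => //.
  + move=> N y; have := @sum_enumerated_le R _ (fun i => A i y ^+ 2) (b ^+ 2)
      (fun s us => sum_sqr_components y us) N.
    apply: le_trans; apply: ler_sum => k _; rewrite /h /enumerated.
    by case: (pickle_inv _) => //=; rewrite expr0n.
  + move=> k; have [[i ->]|->] := h_cases k; first exact: momA.
    by under eq_Rintegral do rewrite expr0n; rewrite Rintegral_probability_cst.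
  + exact: ltW.
- move=> w m Wm.
  have expS k : expR `|l * S k w| <= m.
    rewrite (le_trans (expR_norm_le _))// -lee_fin -Wm.
    rewrite (_ : expR _ + _ = 2 + q k w); last by rewrite /q; ring.
    by rewrite EFinD leeD2l.
  have devA i : `|\sum_m0 (A i (Y m0 w) - \int[mu]_z A i z)| <= ln m / l.
    have := expS (pickle i); rewrite /S hE => e.
    have m0 : 0 < m by apply: lt_le_trans e; exact: expR_gt0.
    rewrite ler_pdivlMr// mulrC -[X in X * _](gtr0_norm l0) -normrM.
    by rewrite -ler_expR lnK.
  apply: (sup_deviation_le sumB (b := b) (L := L)) => //.
  + by move=> k y; exact: (Ab (k, true) y).
  + by move=> k y; exact: (Ab (k, false) y).
  + by move=> k y y'; exact: (lipA (k, true) y).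
  + by move=> k y y'; exact: (lipA (k, false) y).
  + exact: lawY.
  + by move=> k; exact: (devA (k, true)).
  + by move=> k; exact: (devA (k, false)).
Qed.

Lemma measurable_deviation : measurable_fun setT D.
Proof.
apply: (measurable_sup_deviation sumB (b := b) (L := L)) => //.
- by move=> k y; exact: (Ab (k, true) y).
- by move=> k y; exact: (Ab (k, false) y).
- by move=> k y y'; exact: (lipA (k, true) y).
- by move=> k y y'; exact: (lipA (k, false) y).
- exact: lawY.
Qed.

Lemma deviation_ge0 w : (0 <= D w)%E.
Proof.
apply: (sup_deviation_ge0 sumB (b := b) (L := L)) => //.
- by move=> k y; exact: (Ab (k, true) y).
- by move=> k y; exact: (Ab (k, false) y).
- by move=> k y y'; exact: (lipA (k, true) y).
- by move=> k y y'; exact: (lipA (k, false) y).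
- exact: lawY.
Qed.

End exponential_moment_of_deviation.

(** * Constants *)

Section rates.
Context {R : realType}.
Implicit Types s n w G b : R.

(** Up to the factor [n%:R / 2 `^ j], this is the announced rate of convergence;
    here [w] stands for [2 `^ (- j)]. *)
Definition rate s n w G : R := G * Num.sqrt (s * n * w) + s.

Lemma rate_gt0 s n w G : 0 < s -> 0 <= G -> 0 < rate s n w G.
Proof. by move=> s0 G0; rewrite ltr_wpDl// mulr_ge0// sqrtr_ge0. Qed.

Lemma rate_sqr_ge s n w G : 0 < s -> 0 <= n -> 0 <= w -> 0 <= G ->
  G ^+ 2 * (s * n * w) <= rate s n w G ^+ 2.
Proof.
move=> s0 n0 w0 G0.
have x0 : 0 <= s * n * w by rewrite !mulr_ge0// ltW.
rewrite -[X in _ * X](sqr_sqrtr x0) -exprMn lerXn2r ?nnegrE//.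
- by rewrite mulr_ge0// sqrtr_ge0.
- by rewrite ltW// rate_gt0.
- by rewrite /rate lerDl ltW.
Qed.

(** The parameter of the exponential moment.  It is small enough for the quadratic
    bound of the exponential, by [exponent_le], and for the variance to contribute
    no more than [expR s], by [exponent_variance_le]. *)
Definition exponent s n w G b : R := s / (2 * b * rate s n w G).

Lemma exponent_gt0 s n w G b : 0 < s -> 0 <= G -> 0 < b -> 0 < exponent s n w G b.
Proof. by move=> s0 G0 b0; rewrite divr_gt0// !mulr_gt0// rate_gt0. Qed.

Lemma exponent_le s n w G b : 0 < s -> 0 <= G -> 0 < b ->
  2 * (exponent s n w G b * b) <= 1.
Proof.
move=> s0 G0 b0; have Q0 := rate_gt0 n w s0 G0.
rewrite /exponent (_ : 2 * _ = s / rate s n w G); last by field; rewrite !gt_eqF.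
by rewrite ler_pdivrMr// mul1r /rate lerDr mulr_ge0// sqrtr_ge0.
Qed.

Lemma exponent_sqr_le s n w G b : 0 < s -> 0 <= n -> 0 < w -> 1 <= G -> 0 < b ->
  4 * exponent s n w G b ^+ 2 * n * b ^+ 2 <= s / w.
Proof.
move=> s0 n0 w0 G1 b0; have G0 : 0 <= G by lra.
have Q0 := rate_gt0 n w s0 G0.
rewrite /exponent (_ : 4 * _ * _ * _ = s ^+ 2 * n / rate s n w G ^+ 2); last first.
  by field; rewrite !gt_eqF.
rewrite ler_pdivrMr ?exprn_gt0//.
have H : s * n * w <= rate s n w G ^+ 2.
  apply: le_trans (rate_sqr_ge s0 n0 (ltW w0) G0).
  by rewrite ler_peMl ?mulr_ge0 ?(ltW s0) ?(ltW w0)// exprn_ege1.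
rewrite [leRHS]mulrAC ler_pdivlMr// (_ : s ^+ 2 * n * w = s * (s * n * w)); last by ring.
by rewrite ler_pM2l.
Qed.

Lemma exponent_variance_le s n w G b : 0 < s -> 0 <= n -> 0 < w -> 1 <= G -> 0 < b ->
  2 * exponent s n w G b ^+ 2 * n * (G ^+ 2 * w * b ^+ 2) <= s.
Proof.
move=> s0 n0 w0 G1 b0; have G0 : 0 <= G by lra.
have Q0 := rate_gt0 n w s0 G0.
rewrite /exponent (_ : 2 * _ * _ * _ =
  s / 2 * (G ^+ 2 * (s * n * w) / rate s n w G ^+ 2)); last first.
  by field; rewrite !gt_eqF.
have H : G ^+ 2 * (s * n * w) / rate s n w G ^+ 2 <= 1.
  by rewrite ler_pdivrMr ?exprn_gt0// mul1r rate_sqr_ge// ltW.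
apply: (@le_trans _ _ (s / 2 * 1)); last by lra.
by rewrite ler_wpM2l//; lra.
Qed.

Lemma rate_rescaled s n t G : 0 <= s -> 0 < n -> 0 < t ->
  t / n * rate s n t^-1 G = G * Num.sqrt (s * (t / n)) + s * (t / n).
Proof.
move=> s0 n0 t0; have tn0 : 0 <= t / n by rewrite divr_ge0 ?ltW.
rewrite /rate mulrDr; congr (_ + _); last exact: mulrC.
rewrite mulrCA; congr (_ * _).
rewrite -[X in X * _](ger0_norm tn0) -sqrtr_sqr -sqrtrM ?sqr_ge0//.
by congr Num.sqrt; field; rewrite !gt_eqF.
Qed.

End rates.

Section wavelet_condition_consequences.
Context {R : realType}.
Local Notation leb := (@lebesgue_measure R).
Variables (phi psi : R -> R) (a' a : R).
Hypothesis wc : wavelet_condition phi psi a' a.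

Lemma scaling_function_integrable : leb.-integrable setT (EFin \o phi).
Proof.
case: wc => _ [phiL _] _ _ _.
by apply/Lfun1_integrable; exact: phiL.
Qed.

Lemma support_bound_gt0 : 0 < a.
Proof. by case: wc => _ _ /andP[a'0 a'a] _ _; exact: lt_trans a'a. Qed.

Lemma scaling_function_band_limited t : t \notin `[- a, a] ->
  fourier (fun x => (phi x)%:C%C) t = 0.
Proof.
case: wc => _ _ _ [supp _] _ ta; apply/eqP; apply: contraT => Ft.
suff : `[- a, a]%classic t by rewrite /= (negPf ta).
by apply: supp; apply: subset_closure.
Qed.

Lemma translate_sums_bounded : exists2 B : R, 1 <= B &
  forall x : R, (\esum_(k in [set: int]) `|translate phi k x|%:E <= B%:E)%E.
Proof.
case: wc => _ _ _ _ [phiB _].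
rewrite /bounded_translate_sums in phiB.
set S := ereal_sup _ in phiB.
have ubS x : (\esum_(k in [set: int]) `|translate phi k x|%:E <= S)%E.
  by apply: ereal_sup_ubound; exists x.
have S0 : (0 <= S)%E.
  by apply: le_trans (ubS 0); apply: esum_ge0 => k _; rewrite lee_fin.
have Sfin : S \is a fin_num by rewrite ge0_fin_numE.
exists (1 + fine S); first by rewrite lerDl fine_ge0.
move=> x; apply: (le_trans (ubS x)).
by rewrite -[leLHS](fineK Sfin) lee_fin lerDr.
Qed.

End wavelet_condition_consequences.

(** * The deviation bounds *)

Section deviation_bounds.
Context {R : realType}.
Local Notation leb := (@lebesgue_measure R).
Variables (phi : R -> R) (a0 B : R) (N : nat).
Hypothesis iphi : leb.-integrable setT (EFin \o phi).
Local Notation F := (fourier (fun x => (phi x)%:C%C)).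
Hypothesis supp0 : forall t, t \notin `[- a0, a0] -> F t = 0.
Hypotheses (N0 : (0 < N)%N) (a0N : a0 <= N%:R * pi) (B1 : 1 <= B).
Hypothesis sumB : forall x : R, (\esum_(k in [set: int]) `|translate phi k x|%:E <= B%:E)%E.

(** Divided by [delta], this bounds the square root of the sum of the squares of all
    the [phi_tilde k].  It depends on [phi] only. *)
Definition frame_constant : R := 2 * N%:R * (\int[leb]_x `|phi x|) + 1.
Local Notation beta := frame_constant.

Lemma frame_constant_gt0 : 0 < beta.
Proof. by rewrite ltr_wpDl// !mulr_ge0// Rintegral_ge0. Qed.
Let beta0 := frame_constant_gt0.

Variables (a j : R) (err : probability R R).
Hypothesis supp : forall t, t \notin `[- a, a] -> F t = 0.
Hypotheses (a_ge0 : 0 <= a) (j0 : 0 <= j).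
Hypothesis err_pos : forall t, t \in `[- (2 `^ j * a), 2 `^ j * a] ->
  0 < cabs (fourier_measure err t).
Context {d0 : measure_display} {T0 : measurableType d0} {P0 : probability T0 R}.
Variables (X eps : {RV P0 >-> R}) (f : R -> R) (M : R).
Hypotheses (densX : has_density P0 X f) (fM : forall x, f x <= M).
Hypothesis law_eps : forall A : set R, measurable A -> distribution P0 eps A = err A.
Hypothesis indepX : independent2 P0 X eps.
Context {d : measure_display} {T : measurableType d} {P : probability T R}.
Variables (n : nat) (Y : 'I_n -> {RV P >-> R}).
Hypothesis n0 : (0 < n)%N.
Hypothesis lawY : forall m (A : set R), measurable A ->
  distribution P (Y m) A = P0 ((fun w => X w + eps w) @^-1` A).
Hypothesis indepY : mutually_independent P (fun m => Y m : T -> R).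
Variable s : R.
Hypotheses (s1 : 1 <= s) (js : j <= s).

Local Notation D := (sup_deviation phi err j P (fun m => Y m : T -> R)).
Let del := delta err j a.
Let Gam := Linfty_norm (convolution err f).
Let G := Num.max (Num.sqrt Gam) 1.
Let b := beta / del.
Let w : R := 2 `^ (- j).
Let mu : probability R R := distribution P (Y (Ordinal n0)).

Let w0 : 0 < w. Proof. exact: powR_gt0. Qed.
Let s0 : 0 < s. Proof. by have := s1; lra. Qed.
Let del0 : 0 < del. Proof. exact: delta_gt0. Qed.
Let b0 : 0 < b. Proof. by rewrite divr_gt0. Qed.
Let G1 : 1 <= G. Proof. by rewrite /G le_max lexx orbT. Qed.
Let Gam0 : 0 <= Gam. Proof. by have [] := Linfty_norm_convolution err densX fM. Qed.

Let GamG : Gam <= G ^+ 2.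
Proof.
rewrite -[leLHS](sqr_sqrtr Gam0) lerXn2r ?nnegrE ?sqrtr_ge0//.
  by have := G1; lra.
by rewrite /G le_max lexx.
Qed.

Let lawYmu i (A : set R) : measurable A -> distribution P (Y i) A = mu A.
Proof. by move=> mA; rewrite lawY//; exact: esym (lawY _ mA). Qed.

Let A (i : int * bool) y := if i.2 then complex.Re (phi_tilde phi err j i.1 y)
  else complex.Im (phi_tilde phi err j i.1 y).

Let sumA (r : seq int) (y : R) : uniq r ->
  \sum_(k <- r) (complex.Re (phi_tilde phi err j k y) ^+ 2 +
                 complex.Im (phi_tilde phi err j k y) ^+ 2) <= b ^+ 2.
Proof.
move=> ur; apply: le_trans (sum_sqr_phi_tilde iphi supp supp0 a_ge0 N0 a0N err_pos y ur) _.
have l0 : 0 <= \int[leb]_x `|phi x| by apply: Rintegral_ge0.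
rewrite lerXn2r ?nnegrE ?divr_ge0 ?mulr_ge0 ?(ltW del0) ?(ltW beta0)//.
by rewrite ler_pM2r ?invr_gt0// lerDl.
Qed.

Let momA (L : R) (lipA : forall i y y', `|A i y - A i y'| <= L * `|y - y'|) i :
  \int[mu]_y (A i y ^+ 2) <= G ^+ 2 * w * b ^+ 2.
Proof.
have mA i' : measurable_fun setT (A i') := lipschitz_measurable (lipA i').
have mA2 : measurable_fun setT (fun y => A i y ^+ 2) by exact: measurable_funX.
have sq0 y : 0 <= A i y ^+ 2 by exact: sqr_ge0.
have E0 : (0 <= \int[mu]_y (A i y ^+ 2)%:E)%E by apply: integral_ge0 => y _; rewrite lee_fin.
have H : (\int[mu]_y (A i y ^+ 2)%:E <= (G ^+ 2 * w * b ^+ 2)%:E)%E.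
  have mXe : measurable_fun setT (fun w' => X w' + eps w') by exact: measurable_funD.
  have -> : (\int[mu]_y (A i y ^+ 2)%:E = \int[P0]_w' (A i (X w' + eps w') ^+ 2)%:E)%E.
    pose nu : {measure set R -> \bar R} := pushforward P0 (fun w' => X w' + eps w').
    transitivity (\int[nu mXe]_y (A i y ^+ 2)%:E)%E.
      by apply: eq_measure_integral => C mC _; exact: lawY.
    have mE : measurable_fun setT (fun y => (A i y ^+ 2)%:E) by exact/measurable_EFinP.
    by rewrite ge0_integral_pushforward// => z _; rewrite lee_fin.
  apply: (le_trans (expectation_le_Linfty densX fM law_eps indepX mA2 sq0)).
  rewrite -/Gam -mulrA EFinM; apply: lee_pmul; rewrite ?lee_fin//.
    by apply: integral_ge0 => y _; rewrite lee_fin.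
  apply: (@integral_sqr_shifted_family _ (fun k => A (k, i.2)) _ _ w0 _ _ _ i.1).
  - by move=> k; exact: mA.
  - move=> k l y; have E := phi_tilde_shift err j iphi supp0 a0N k l y.
    by rewrite /A; case: (i.2);
      [exact: (congr1 (@complex.Re R) E)|exact: (congr1 (@complex.Im R) E)].
  - move=> r y ur; apply: le_trans (sumA y ur); apply: ler_sum => k _.
    by rewrite /A; case: (i.2); rewrite ?lerDl ?lerDr sqr_ge0.
rewrite -lee_fin /Rintegral fineK// ge0_fin_numE//.
by rewrite (le_lt_trans H)// ltry.
Qed.

Let u0 : R := 2 `^ j / n%:R.
(** 24 is the product of 2, for the real and imaginary parts, of 2, from [exponent],
    and of 6, from the level used in [tail_bound]. *)
Let c : R := 24 * beta * B / del * (G * Num.sqrt (s * u0) + s * u0).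

Let exponential_bound : exists W : T -> \bar R,
  [/\ measurable_fun setT W, forall x, (2%:E <= W x)%E,
      (\int[P]_x W x <= (expR (5 * s))%:E)%E &
      forall x m, W x = m%:E -> (D x <= (c * ln m / (6 * s))%:E)%E] /\
  measurable_fun setT D /\ forall x, (0 <= D x)%E.
Proof.
have [L [L0 lip]] := phi_tilde_lipschitz iphi supp supp0 a_ge0 N0 a0N err_pos.
have lipA i y y' : `|A i y - A i y'| <= L * `|y - y'|.
  by rewrite /A; have [] := lip i.1 y y'; case: (i.2).
have nR0 : 0 < n%:R :> R by rewrite ltr0n.
have G0 : 0 <= G by have := G1; lra.
pose l := exponent s n%:R w G b.
have l0 : 0 < l by exact: exponent_gt0.
have lb : 2 * (l * b) <= 1 by exact: exponent_le.
have s20 : 0 <= G ^+ 2 * w * b ^+ 2 by rewrite mulr_ge0 ?sqr_ge0// mulr_ge0 ?sqr_ge0// ltW.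
have [W [mW W2 EW DW]] := exponential_moment_of_deviation sumB (ltW b0) sumA lipA
  indepY lawYmu (momA lipA) l0 lb s20.
exists W; split; last split.
- split => //.
    apply: (le_trans EW); rewrite lee_fin.
    apply: le_trans (exponential_moment_constant s1 j0 js).
    rewrite lerD2l; apply: ler_pM.
    - by rewrite mulr_ge0 ?sqr_ge0// mulr_ge0 ?(ltW nR0)// mulr_ge0// sqr_ge0.
    - exact: expR_ge0.
    - have := exponent_sqr_le s0 (ltW nR0) w0 G1 b0; rewrite -/l.
      by rewrite /w powRN invrK.
    - by rewrite ler_expR; exact: exponent_variance_le s0 (ltW nR0) w0 G1 b0.
  move=> x m Wm; apply: (le_trans (DW x m Wm)); rewrite lee_fin.
  rewrite /c -(rate_rescaled G (ltW s0) nR0 (powR_gt0 j (ltr0n R 2))) -powRN -/w.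
  rewrite /l /exponent /b; have Q0 := rate_gt0 n%:R w s0 G0.
  move: (rate _ _ _ _) Q0 => Q Q0; move: (ln m) => lm.
  move: (2 `^ j) (n%:R) nR0 => t n' n'0.
  rewrite le_eqVlt; apply/orP; left; apply/eqP.
  move: (del) del0 (beta) beta0 => d' d'0 be be0.
  by field; rewrite !gt_eqF.
- exact: (measurable_deviation sumB (ltW b0) L0 sumA lipA lawYmu).
- exact: (deviation_ge0 sumB (ltW b0) sumA lipA lawYmu).
Qed.

Let c0 : 0 < c.
Proof.
have u00 : 0 < u0 by rewrite divr_gt0 ?powR_gt0 ?ltr0n.
rewrite mulr_gt0//.
  by rewrite divr_gt0// !mulr_gt0// (lt_le_trans _ B1).
apply: ltr_wpDl; last exact: mulr_gt0.
by rewrite mulr_ge0 ?sqrtr_ge0//; have := G1; lra.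
Qed.

Lemma deviation_tail : (P [set x | (c%:E <= D x)] <= (expR (- s))%:E)%E.
Proof.
have [W [[mW W2 EW DW] [mD D0]]] := exponential_bound.
exact: (tail_bound mD mW W2 s1 c0 DW EW).
Qed.

Lemma deviation_moment p : 1 <= p ->
  ((\int[P]_x (D x `^ p)) `^ p^-1 <=
   (c * (1 + power_exp_constant p) `^ p^-1)%:E)%E.
Proof.
have [W [[mW W2 EW DW] [mD D0]]] := exponential_bound.
exact: (moment_bound mD mW D0 W2 s1 c0 DW EW).
Qed.

End deviation_bounds.

Theorem proposition1 (R : realType) (phi psi : R -> R) :
  exists C : R, forall p : R, 1 <= p -> exists L' : R,
  forall (a' a : R), wavelet_condition phi psi a' a ->
  forall (j : R), 0 <= j ->
  forall (err : probability R R),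
    (forall t, t \in `[- (2 `^ j * a), 2 `^ j * a] ->
       0 < cabs (fourier_measure err t)) ->
  forall (d0 : measure_display) (T0 : measurableType d0)
    (P0 : probability T0 R) (X eps : {RV P0 >-> R}) (f : R -> R),
    has_density P0 X f ->
    (exists M : R, forall x, f x <= M) ->
    (forall A : set R, measurable A -> distribution P0 eps A = err A) ->
    independent2 P0 X eps ->
  forall (n : nat), (1 <= n)%N ->
  forall (d : measure_display) (T : measurableType d)
    (P : probability T R) (Y : 'I_n -> {RV P >-> R}),
    (forall m (A : set R), measurable A ->
       distribution P (Y m) A = P0 ((fun w => X w + eps w) @^-1` A)) ->
    mutually_independent P (fun m => Y m : T -> R) ->
  let j' := Num.max 1 j in
  let G := Num.max (Num.sqrt (Linfty_norm (convolution err f))) 1 in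
  let D := sup_deviation phi err j P (fun m => Y m : T -> R) in
  let v := 2 `^ j * j' / n%:R in
  ((\int[P]_w (D w `^ p)) `^ p^-1 <=
     (L' / delta err j a * (G * Num.sqrt v + v))%:E)%E /\
  (forall u : R, 0 < u ->
     (P [set w | (C / delta err j a *
                   (G * Num.sqrt ((1 + u) * v) + (1 + u) * v))%:E <= D w] <=
      (expR (- ((1 + u) * j')))%:E)%E).
Proof.
(* The constants may depend on [phi] and [psi] only, whereas several bands [a] may be
   admissible.  They are built from one admissible band [a0]; if there is none,
   nothing has to be shown. *)
have [[a0' [a0 wc0]]|nowc] := pselect (exists a0' a0, wavelet_condition phi psi a0' a0);
  last first.
  exists 0 => p _; exists 0 => a' a wc; exfalso; apply: nowc.
  by exists a', a.
have [B B1 sumB] := translate_sums_bounded wc0.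
have iphi := scaling_function_integrable wc0.
have supp0 := scaling_function_band_limited wc0.
pose N := (Num.truncn a0).+1.
have a0N : a0 <= N%:R * pi.
  have aN : a0 < N%:R by rewrite /N truncnS_gt.
  rewrite (le_trans (ltW aN))// ler_peMr// (le_trans _ (pi_ge2 R))//; lra.
pose C := 24 * frame_constant phi N * B.
exists C => p p1; exists (C * (1 + power_exp_constant p) `^ p^-1).
move=> a' a wc j j0 err err_pos d0 T0 P0 X eps f densX [M fM] law_eps indepX n n0
  d T P Y lawY indepY j' G D v.
have j'1 : 1 <= j' by rewrite le_max lexx.
have jj' : j <= j' by rewrite le_max lexx orbT.
have vE s : s * v / j' = s * (2 `^ j / n%:R).
  by rewrite /v; field; rewrite !gt_eqF ?ltr0n//; lra.
(* The moments come from the level [s = j'], the tails from [s = (1 + u) * j']. *)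
split.
  have := deviation_moment iphi supp0 (isT : (0 < N)%N) a0N B1 sumB
    (scaling_function_band_limited wc) (ltW (support_bound_gt0 wc)) j0 err_pos
    densX fM law_eps indepX n0 lawY indepY j'1 jj' p1.
  rewrite -/C -/G -/D => H; apply: (le_trans H); rewrite lee_fin.
  have -> : j' * (2 `^ j / n%:R) = v by rewrite /v; ring.
  rewrite le_eqVlt; apply/orP; left; apply/eqP; ring.
move=> u u0; have s1 : 1 <= (1 + u) * j' by nra.
have js : j <= (1 + u) * j' by nra.
have := deviation_tail iphi supp0 (isT : (0 < N)%N) a0N B1 sumB
  (scaling_function_band_limited wc) (ltW (support_bound_gt0 wc)) j0 err_pos
  densX fM law_eps indepX n0 lawY indepY s1 js.
rewrite -/C -/G -/D.
by have -> : (1 + u) * j' * (2 `^ j / n%:R) = (1 + u) * v by rewrite /v; ring.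
Qed.
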